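(* Let $q\geq 1$ and $2\leq t\leq 2^q$ be integers and let $d=7\cdot 2^q-2t$. For any $2^{q+1}-2$ masses on $\mathbb{R}^d$, there exist four pairwise orthogonal hyperplanes $H_1,H_2,H_3,H_4$ in $\mathbb{R}^d$ such that (i) any three of $H_1,H_2,H_3,H_4$ equipartition each of some prescribed $2^{q+1}-t$ of the masses, and (ii) any two of $H_2,H_3,H_4$ equipartition each of the remaining $t-2$ masses.
   Context: A mass on $\mathbb{R}^d$ is a finite Borel measure on $\mathbb{R}^d$ absolutely continuous with respect to Lebesgue measure. A hyperplane $H=\{\langle u,a\rangle=b\}$ ($a\neq0$) has closed half-spaces $H^+=\{\langle u,a\rangle\geq b\}$, $H^-=\{\langle u,a\rangle\leq b\}$. Hyperplanes $H_{i_1},\dots,H_{i_\ell}$ equipartition $\mu$ if each of the $2^\ell$ regions $H_{i_1}^{\pm}\cap\cdots\cap H_{i_\ell}^{\pm}$ has $\mu$-measure $\mu(\mathbb{R}^d)/2^\ell$. Hyperplanes are pairwise orthogonal if their normal vectors are pairwise orthogonal. *)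

(* Defs.v *)
From HB Require Import structures.
From mathcomp Require Import all_boot all_order all_algebra.
From mathcomp Require Import all_classical all_reals all_analysis.
Set Implicit Arguments. Unset Strict Implicit. Unset Printing Implicit Defensive.
Import Order.TTheory GRing.Theory Num.Theory.
Import numFieldNormedType.Exports.
Local Open Scope classical_set_scope.
Local Open Scope ring_scope.

Definition vec (R : realType) (d : nat) := 'rV[R]_d.

Definition borelR (R : realType) (d : nat) :=
  g_sigma_algebraType (@open 'rV[R]_d).

Definition dotv (R : realType) (d : nat) (u v : 'rV[R]_d) : R :=
  \sum_(i < d) u 0 i * v 0 i.

Definition box (R : realType) (d : nat) (a b : 'rV[R]_d) : set 'rV[R]_d :=
  [set x | forall i : 'I_d, a 0 i <= x 0 i <= b 0 i].
Definition boxvol (R : realType) (d : nat) (a b : 'rV[R]_d) : R :=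
  \prod_(i < d) (b 0 i - a 0 i).

Definition lebesgue_null (R : realType) (d : nat) (A : set 'rV[R]_d) : Prop :=
  forall eps : R, 0 < eps ->
    exists a b : nat -> 'rV[R]_d,
      (forall n (i : 'I_d), a n 0 i <= b n 0 i) /\
      A `<=` \bigcup_n box (a n) (b n) /\
      (\sum_(0 <= n <oo) (boxvol (a n) (b n))%:E <= eps%:E)%E.

Definition is_mass (R : realType) (d : nat)
    (mu : {measure set (borelR R d) -> \bar R}) : Prop :=
  (mu setT < +oo)%E /\
  (forall A : set (borelR R d), measurable A -> lebesgue_null A -> mu A = 0%E).

(* A hyperplane H = {u | <u,a> = b} is given by a pair (a, b) with a <> 0. *)
Definition hyperplane (R : realType) (d : nat) := ('rV[R]_d * R)%type.

Definition halfspace (R : realType) (d : nat) (H : hyperplane R d) (s : bool)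
    : set 'rV[R]_d :=
  if s then [set u | H.2 <= dotv u H.1] else [set u | dotv u H.1 <= H.2].

(* The hyperplanes H_i, i in S, equipartition mu: each of the 2^|S| regions
   cut out by choosing one closed half-space of every H_i (i in S) has
   measure mu(R^d)/2^|S|.  (A region is determined by a sign vector s; the
   values of s outside S are irrelevant.) *)
Definition equipartition (R : realType) (d k : nat)
    (H : 'I_k -> hyperplane R d) (S : {set 'I_k})
    (mu : {measure set (borelR R d) -> \bar R}) : Prop :=
  forall s : 'I_k -> bool,
    mu (\bigcap_(i in [set i | i \in S]) halfspace (H i) (s i))
    = (mu setT * ((2 ^+ #|S|)^-1)%:E)%E.

Definition pairwise_orthogonal_hyperplanes (R : realType) (d k : nat)
    (H : 'I_k -> hyperplane R d) : Prop :=
  (forall i, (H i).1 != 0) /\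
  (forall i j, i != j -> dotv (H i).1 (H j).1 = 0).

(* Main.v *)
(** Four hyperplanes are encoded by a point of ([-1,1]^d)^4, each factor being
    a disc whose boundary carries the antipodal action; the Walsh transforms of
    the masses over the sets of at most three (at most two) hyperplanes, the
    inner products of the normals and six zero functions are 4d tests, odd or
    even in each block, whose common zeros are the solutions.

    A common zero exists because a mod 2 number is nonzero.  At chain level it
    is the cup product of the coboundaries of the signs of the tests, summed
    over a symmetric Freudenthal triangulation of the cube.  By Stokes it depends
    only on the symmetry types of the tests, and lexicographic signs evaluate it
    as the coefficient of (u0 u1 u2 u3)^d in the product over the tests of the
    linear forms sum_(j in T) u_j.  Compactness then gives an exact zero.

    With E and F the products of the forms over the sets T of size <= 3 in
    {0,1,2,3} and of size <= 2 in {1,2,3}, and V the product of the u_i + u_j,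
    this is a coefficient of E^(2^(q+1)-t) F^(t-2) V u1 u2^2 u3^3 over F_2.
    Since the coefficients of W p^2 at even exponents are those of C(W) p, with
    C(W) the even part of W with exponents halved, reading the binary digits of
    t moves W around a finite set of polynomials. *)
Require Import Defs.
From HB Require Import structures.
From mathcomp Require Import all_boot all_order all_algebra all_fingroup.
From mathcomp Require Import all_classical all_reals all_analysis.
From mathcomp Require Import zify ring lra.
Import Order.TTheory GRing.Theory Num.Theory.
Import numFieldNormedType.Exports.
Set Implicit Arguments. Unset Strict Implicit. Unset Printing Implicit Defensive.
Local Open Scope ring_scope.

(** * Pairwise cancellation and the Leibniz rule over F_2 *)

Lemma addF2 (x : 'F_2) : x + x = 0.
Proof. by have /= := addrr_pchar2 (pchar_Fp (isT : prime 2)) x. Qed.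

(** An involution without fixed points pairs equal terms, which cancel mod 2. The element of smaller
    enumeration rank represents each pair. *)
Lemma sumF2_involution (T : finType) (P : pred T) (h : T -> T) (F : T -> 'F_2) :
  (forall x, P x -> P (h x)) -> (forall x, P x -> h (h x) = x) ->
  (forall x, P x -> h x != x) -> (forall x, P x -> F (h x) = F x) ->
  \sum_(x | P x) F x = 0.
Proof.
move=> hP hK hn hF.
rewrite (bigID (fun x => (enum_rank x < enum_rank (h x))%N)) /=.
rewrite [X in _ + X](reindex_onto h h) /=; last by move=> x /andP[Px _]; exact: hK.
rewrite [X in _ + X](_ : _ = \sum_(x | P x && (enum_rank x < enum_rank (h x))%N) F x);
  first exact: addF2.
symmetry; apply: eq_big => [x|x /andP[Px _]]; last by rewrite hF.
apply/andP/andP => [[Px lt]|[/andP[Px le] /eqP e]].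
  by rewrite hP // hK // -leqNgt eqxx (ltnW lt).
have Px' : P x by rewrite -e; exact: hP.
split=> //; rewrite ltn_neqAle.
move: le; rewrite hK // -leqNgt => ->; rewrite andbT.
apply/eqP => /val_inj /enum_rank_inj eh.
by move: (hn _ Px'); rewrite -eh eqxx.
Qed.

Section Leibniz.
Variables (P : Type) (N : nat) (s : nat -> P -> 'F_2) (g : P -> 'F_2) (m : nat).

(* The cup product ds_0 ... ds_(m-1) g ds_(m+1) ... ds_(N-1), evaluated on the
   simplex with vertices v 0, ..., v (N-1). *)
Definition cochain (v : nat -> P) : 'F_2 :=
  (\prod_(0 <= i < m) (s i (v i.+1) + s i (v i))) * g (v m) *
  \prod_(m.+1 <= i < N) (s i (v i) + s i (v i.-1)).

Let dl (v : nat -> P) i := s i (v i.+1) + s i (v i).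
(** [A v l] and [B v l] are products along the path v 0, ..., v N with one edge left out: the edge
    from v l to v (l+1) in [A], from v (l-1) to v l in [B]. A face that skips an inner vertex is the
    sum of two consecutive such products, so the sum over faces telescopes on both sides of position
    [m]. *)
Let A v l := (\prod_(0 <= i < l) dl v i) *
  (\prod_(l <= i < m) (s i (v i.+2) + s i (v i.+1))) * g (v m.+1) *
  \prod_(m.+1 <= i < N) dl v i.
Let B v l := (\prod_(0 <= i < m) dl v i) * g (v m) *
  ((\prod_(m.+1 <= i < l) (s i (v i) + s i (v i.-1))) * \prod_(l <= i < N) dl v i).

(** The factors ds_i are cocycles, so the coboundary of the product only differentiates [g]. The
    telescoping sums leave [A v m] and [B v m.+1], which differ in the argument of [g] alone. *)
Lemma cochain_coboundary (v : nat -> P) : (m < N)%N ->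
  \sum_(0 <= l < N.+1) cochain (v \o bump l) =
  (\prod_(0 <= i < m) (s i (v i.+1) + s i (v i))) * (g (v m.+1) + g (v m)) *
  \prod_(m.+1 <= i < N) (s i (v i.+1) + s i (v i)).
Proof.
move=> mN.
have tele (a b c : 'F_2) : a + c = (a + b) + (b + c).
  by rewrite addrA -[a + b + b]addrA addF2 addr0.
have bumpE l i : bump l i = if (l <= i)%N then i.+1 else i by rewrite /bump; case: leqP.
have hA0 : cochain (v \o bump 0) = A v 0.
  rewrite /cochain /A /= [X in _ = X * _ * _ * _]big_geq // mul1r.
  rewrite !bumpE; congr (_ * _ * _); apply: eq_big_nat => i /andP[i1 i2]; rewrite !bumpE //=.
  by rewrite prednK //; case: i i1 i2.
have hA l : (0 < l <= m)%N -> cochain (v \o bump l) = A v l.-1 + A v l.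
  case: l => // l /andP[_ lm]; rewrite /cochain /A /= !bumpE lm.
  rewrite -2!mulrDl; congr (_ * _ * _); last first.
    apply: eq_big_nat => i /andP[i1 i2]; rewrite !bumpE.
    rewrite (ltn_trans lm i1) prednK; last by case: i i1 i2.
    by rewrite -ltnS prednK ?(leq_trans _ i1) //; case: i i1 i2.
  rewrite (big_cat_nat (n := l)) //=; last exact: ltnW.
  rewrite [X in _ * X = _]big_ltn // [X in _ = _ * X + _]big_ltn //.
  rewrite [X in _ = _ + X * _]big_nat_recr //= !bumpE ltnSn ltnn.
  have -> : \prod_(0 <= i < l) (s i (v (bump l.+1 i.+1)) + s i (v (bump l.+1 i))) =
            \prod_(0 <= i < l) dl v i.
    apply: eq_big_nat => i /andP[_ il]; rewrite !bumpE ltnS.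
    by rewrite [(l <= i)%N]leqNgt il /= ltnNge (ltnW il).
  have -> : \prod_(l.+1 <= i < m) (s i (v (bump l.+1 i.+1)) + s i (v (bump l.+1 i))) =
            \prod_(l.+1 <= i < m) (s i (v i.+2) + s i (v i.+1)).
    by apply: eq_big_nat => i /andP[il _]; rewrite !bumpE il ltnS (ltnW il).
  set X := \prod_(0 <= i < l) _; set Y := \prod_(l.+1 <= i < m) _.
  by rewrite /dl (tele _ (s l (v l.+1))) mulrDl mulrDr !mulrA.
have hB l : (m < l < N)%N -> cochain (v \o bump l) = B v l + B v l.+1.
  move=> /andP[ml lN]; rewrite /cochain /B /= !bumpE leqNgt ml /=.
  have -> : \prod_(0 <= i < m) (s i (v (bump l i.+1)) + s i (v (bump l i))) =
            \prod_(0 <= i < m) dl v i.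
    apply: eq_big_nat => i /andP[_ im]; rewrite !bumpE.
    by rewrite leqNgt (leq_ltn_trans im ml) /= leqNgt (ltn_trans im ml).
  rewrite -mulrDr; congr (_ * _).
  rewrite (big_cat_nat (n := l)) //=; last exact: ltnW.
  rewrite [X in _ * X = _]big_ltn // [X in _ = _ * X + _ ]big_ltn //.
  rewrite [X in _ = _ + X * _]big_nat_recr //=.
  have -> : \prod_(m.+1 <= i < l) (s i (v (bump l i)) + s i (v (bump l i.-1))) =
            \prod_(m.+1 <= i < l) (s i (v i) + s i (v i.-1)).
    apply: eq_big_nat => i /andP[mi il]; rewrite !bumpE leqNgt il /=.
    by rewrite leqNgt (leq_ltn_trans (leq_pred _) il).
  have -> : \prod_(l.+1 <= i < N) (s i (v (bump l i)) + s i (v (bump l i.-1))) =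
            \prod_(l.+1 <= i < N) dl v i.
    apply: eq_big_nat => i /andP[li iN]; rewrite !bumpE (ltnW li).
    by rewrite -ltnS prednK ?li //; case: i li iN.
  rewrite !bumpE leqnn -ltnS prednK ?ltnn; last by case: l ml lN.
  set X := \prod_(m.+1 <= i < l) _; set Y := \prod_(l.+1 <= i < N) _.
  by rewrite /dl (tele _ (s l (v l))) mulrDl mulrDr !mulrA.
have hBN : cochain (v \o bump N) = B v N.
  rewrite /cochain /B /= [X in _ * (_ * X)]big_geq // mulr1 !bumpE leqNgt mN /=.
  congr (_ * _ * _); apply: eq_big_nat => i /andP[i1 i2]; rewrite !bumpE.
    by rewrite leqNgt (leq_ltn_trans i2 mN) leqNgt (ltn_trans i2 mN).
  by rewrite leqNgt i2 leqNgt (leq_ltn_trans (leq_pred _) i2).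
rewrite (big_cat_nat (n := m.+1)) //=; last by rewrite ltnS ltnW.
have -> : \sum_(0 <= l < m.+1) cochain (v \o bump l) = A v m.
  have : forall k, (k <= m)%N -> \sum_(0 <= l < k.+1) cochain (v \o bump l) = A v k.
    elim=> [_|k IH km]; first by rewrite big_nat1.
    rewrite big_nat_recr //= IH ?(ltnW km) // hA //=.
    by rewrite addrA addF2 add0r.
  exact.
have -> : \sum_(m.+1 <= l < N.+1) cochain (v \o bump l) = B v m.+1.
  have : forall k, (m < k <= N)%N -> \sum_(m.+1 <= l < k) cochain (v \o bump l) = B v m.+1 + B v k.
    elim=> // k IH /andP[]; rewrite ltnS leq_eqVlt => /orP[/eqP<- _|mk kN].
      by rewrite big_geq // addF2.
    rewrite big_nat_recr //= IH ?mk ?(ltnW kN) // hB ?mk //.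
  move=> /(_ N); rewrite mN leqnn => /(_ isT) h.
  by rewrite big_nat_recr //= h hBN -addrA addF2 addr0.
rewrite /A /B [X in _ * X * _ * _ + _]big_geq // mulr1 [X in _ + _ * (X * _)]big_geq // mul1r.
by rewrite -mulrDl -mulrDr.
Qed.

End Leibniz.

(** * The symmetric Freudenthal triangulation of the cube and its faces *)

Section Freudenthal.
Variables (N M : nat) (J : finType) (blk : 'I_N.+1 -> J).

Definition gridpt : predArgType := {ffun 'I_N.+1 -> int}.

(** The triangulation of the positive orthant is reflected into all others; this makes it invariant
    under every change of signs of coordinates, in particular under the antipodes of the blocks. *)
Definition simplex : predArgType :=
  ({ffun 'I_N.+1 -> bool} * {ffun 'I_N.+1 -> 'I_M.+1} * {perm 'I_N.+1})%type.

(* The l-th vertex of the simplex (e, y, r): the coordinates move away from 0,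
   in the orthant e, from y to y + 1, coordinate i being the r i-th to move. *)
Definition vertex (t : simplex) (l : nat) : gridpt :=
  [ffun i => (-1) ^+ (t.1.1 i) * (t.1.2 i + (t.2 i < l))%N%:Z].

Definition flip (j : J) (p : gridpt) : gridpt :=
  [ffun i => if blk i == j then - p i else p i].

Definition in_grid (p : gridpt) := forall i, (`|p i| <= M.+1)%N.

Lemma vertex_in_grid t l : in_grid (vertex t l).
Proof.
move=> i; rewrite ffunE abszMsign /=.
have := ltn_ord (t.1.2 i); case: (_ < l)%N; lia.
Qed.

Lemma flip_vertex e y r j l :
  flip j (vertex (e, y, r) l) =
  vertex ([ffun i => (blk i == j) (+) e i], y, r) l.
Proof.
apply/ffunP => i; rewrite !ffunE /=.
by case: (blk i == j) => //=; rewrite signrN mulNr.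
Qed.

Section Boundary.
Variable Psi : (nat -> gridpt) -> 'F_2.
Hypothesis Psi_ext : forall v v' : nat -> gridpt,
  (forall k, (k <= N)%N -> v k = v' k) -> Psi v = Psi v'.
Hypothesis Psi_flip : forall (v : nat -> gridpt) i,
  (forall k, (k <= N)%N -> in_grid (v k)) ->
  (forall k, (k <= N)%N -> `|v k i|%N = M.+1) ->
  Psi (flip (blk i) \o v) = Psi v.

(** Exchanging the two moves next to vertex [l] changes no other vertex, so the simplices sharing
    this face come in pairs. *)
Lemma sum_inner_face l : (0 < l < N.+1)%N ->
  \sum_(t : simplex) Psi (vertex t \o bump l) = 0.
Proof.
case: l => // l; rewrite /= ltnS => lN.
have l1 : (l < N.+1)%N by exact: ltnW.
pose a := Ordinal l1; pose b := Ordinal (lN : (l.+1 < N.+1)%N).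
pose h (t : simplex) : simplex := (t.1, (t.2 * tperm a b)%g).
have nab : a != b by rewrite -val_eqE /= ltn_eqF.
apply: (@sumF2_involution _ _ h) => //.
- by case=> ey r _; rewrite /h /= -mulgA tperm2 mulg1.
- case=> ey r _; rewrite /h /=; apply/eqP => -[] /(congr1 (fun p => (r^-1 * p)%g)).
  rewrite mulKg mulVg => /permP/(_ a); rewrite tpermL perm1 => /esym/eqP.
  by rewrite (negPf nab).
- case=> [[e y] r] _; apply: Psi_ext => k kN /=; apply/ffunP => i; rewrite !ffunE /= permM.
  congr (_ * (_ + nat_of_bool _)%N%:Z).
  case: tpermP => [->|->|//] /=; rewrite /bump; case: (leqP l.+1 k) => h0 /=; lia.
Qed.

Let first (t : simplex) := (t.2^-1)%g ord0.
Let last (t : simplex) := (t.2^-1)%g ord_max.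

Lemma sum_outer_faces :
  \sum_(t : simplex) Psi (vertex t \o bump 0) +
  \sum_(t : simplex) Psi (vertex t \o bump N.+1) = 0.
Proof.
rewrite (bigID (fun t : simplex => (t.1.2 (first t) < M)%N)) /=.
rewrite [X in _ + X + _](_ : _ = 0) ?addr0; last first.
  (* The first coordinate to move ends at M + 1, so this face lies on the boundary of the cube;
     flipping the whole block of that coordinate pairs it with an antipodal face. *)
  pose h (t : simplex) : simplex :=
    ([ffun i => (blk i == blk (first t)) (+) t.1.1 i], t.1.2, t.2).
  apply: (@sumF2_involution _ _ h) => //.
  - case=> [[e y] r] _; rewrite /h /first /=; congr (_, _, _).
    by apply/ffunP => i; rewrite !ffunE addKb.
  - case=> [[e y] r] _; rewrite /h /first /=; apply/eqP => -[] /ffunP/(_ ((r^-1)%g ord0)).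
    by rewrite ffunE eqxx /=; case: (e _).
  - case=> [[e y] r] /=; rewrite /first /= => hy.
    rewrite -(Psi_flip (v := vertex (e, y, r) \o bump 0) (i := (r^-1)%g ord0)).
    + by apply: Psi_ext => k kN /=; rewrite flip_vertex.
    + by move=> k _; exact: vertex_in_grid.
    + move=> k _ /=; rewrite ffunE abszMsign /= permKV /bump leq0n ltnS leq0n addn1.
      by congr _.+1; apply/eqP; rewrite eqn_leq -ltnS ltn_ord leqNgt.
rewrite [X in _ + X](bigID (fun t : simplex => (0 < t.1.2 (last t))%N)) /=.
rewrite [X in _ + (_ + X)](_ : _ = 0) ?addr0; last first.
  (* The last coordinate to move stays 0 on this face; reversing its sign alone gives the simplex
     across the coordinate hyperplane with the same face. *)
  pose h (t : simplex) : simplex :=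
    ([ffun i => (i == last t) (+) t.1.1 i], t.1.2, t.2).
  apply: (@sumF2_involution _ _ h) => //.
  - case=> [[e y] r] _; rewrite /h /last /=; congr (_, _, _).
    by apply/ffunP => i; rewrite !ffunE addKb.
  - case=> [[e y] r] _; rewrite /h /last /=; apply/eqP => -[] /ffunP/(_ ((r^-1)%g ord_max)).
    by rewrite ffunE eqxx /=; case: (e _).
  - case=> [[e y] r] /=; rewrite /last /= -eqn0Ngt => /eqP hy.
    apply: Psi_ext => k kN /=; apply/ffunP => i; rewrite !ffunE /=.
    case: eqP => [->|//]; rewrite permKV hy /= add0n.
    have -> : (N < bump N.+1 k)%N = false by rewrite /bump; lia.
    by rewrite !mulr0.
(* The remaining faces match one to one: a simplex without vertex 0 is the simplex without its last
   vertex that starts one step further and makes the first move last. The cyclic shift [c] effects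
   this reordering. *)
pose c : {perm 'I_N.+1} := perm (@ord_pred_inj N.+1).
pose up (k : 'I_M.+1) : 'I_M.+1 := inord k.+1.
pose dn (k : 'I_M.+1) : 'I_M.+1 := inord k.-1.
pose h (t : simplex) : simplex :=
  (t.1.1, [ffun i => if i == first t then up (t.1.2 i) else t.1.2 i], (t.2 * c)%g).
pose h' (t : simplex) : simplex :=
  (t.1.1, [ffun i => if i == last t then dn (t.1.2 i) else t.1.2 i], (t.2 * c^-1)%g).
have c0 : c ord0 = ord_max by rewrite permE; apply: val_inj; rewrite /= modn_small.
have cE (k : 'I_N.+1) : (0 < k)%N -> c k = k.-1 :> nat.
  case: k => -[//|k] hk _ /=; rewrite permE /= modnDr modn_small //.
  exact: ltnW.
have firstE t : last (h t) = first t.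
  by rewrite /last /first /h /= invMg permM -c0 permK.
have lastE t : first (h' t) = last t.
  by rewrite /last /first /h' /= invMg permM invgK c0.
rewrite [X in _ + X](reindex_onto h h') /=; last first.
  case=> [[e y] r] hy; rewrite /h; congr (_, _, _).
    apply/ffunP => i; rewrite !ffunE lastE.
    case: eqP => // ->; rewrite ?eqxx; apply: val_inj.
    have yM := ltn_ord (y (last (e, y, r))); rewrite /= in hy.
    rewrite /up /dn /= !inordK; lia.
  by rewrite /= mulgKV.
rewrite [X in X + _](_ : _ = \sum_(j | (0 < (h j).1.2 (last (h j)))%N && (h' (h j) == j))
    Psi (vertex (h j) \o bump N.+1)); first exact: addF2.
apply: eq_big => [t|].
  rewrite firstE /h /= ffunE eqxx.
  case: (ltnP (t.1.2 (first t)) M) => hy; symmetry.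
    rewrite /up inordK //=.
    apply/eqP; case: t hy => [[e y] r] hy; rewrite /h'; congr (_, _, _).
      apply/ffunP => i; rewrite !ffunE firstE; case: eqP => [->|//].
      rewrite ?eqxx; apply: val_inj; rewrite /= in hy.
      by rewrite /dn /up /= !inordK; lia.
    by rewrite /= mulgK.
  apply/negbTE; rewrite negb_and.
  have -> : t.1.2 (first t) = ord_max.
    by apply: val_inj; apply/eqP; rewrite eqn_leq hy -ltnS ltn_ord.
  by rewrite /up /inord /insubd insubN ?ltnn //= ; left.
case=> [[e y] r] hy; apply: Psi_ext => k kN /=; apply/ffunP => i; rewrite !ffunE /=.
congr (_ * _%:Z).
rewrite /bump /= add1n [(N < k)%N]ltnNge kN add0n permM.
case: eqP => [->|ni].
  by rewrite /first /= permKV c0 ltn0Sn addn1 ltnNge kN addn0 /up inordK.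
have ri0 : (0 < r i)%N.
  rewrite lt0n; apply/eqP => ri; apply: ni; rewrite /first /=.
  by apply: (@perm_inj _ r); rewrite permKV; apply: val_inj.
rewrite cE //; congr (_ + nat_of_bool _)%N; lia.
Qed.

(** Stokes mod 2: with antipodal boundary faces identified, the triangulated cube is a cycle. *)
Lemma sum_faces :
  \sum_(t : simplex) \sum_(0 <= l < N.+2) Psi (vertex t \o bump l) = 0.
Proof.
rewrite exchange_big /= big_ltn // big_nat_recr //= addrCA sum_outer_faces addr0.
by rewrite big_nat_cond big1 // => l /andP[hl _]; exact: sum_inner_face.
Qed.

End Boundary.

(** * Labellings of given symmetry and the invariance of their count *)

Definition on_face (j : J) (p : gridpt) := exists2 i, blk i = j & `|p i|%N = M.+1.

(** [al j] tells whether [f] is odd or even under the antipode of block [j]; the condition concerns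
    only the boundary faces of that block. *)
Definition labelling (al : J -> bool) (f : gridpt -> 'F_2) :=
  forall j p, in_grid p -> on_face j p -> f (flip j p) = f p + (al j)%:R.

(** The cup product of the coboundaries of the labels [s 0], ..., [s N], evaluated on the sum of all
    simplices. *)
Definition sign_changes (s : nat -> gridpt -> 'F_2) : 'F_2 :=
  \sum_(t : simplex) \prod_(0 <= i < N.+1) (s i (vertex t i.+1) + s i (vertex t i)).

(** The two counts differ by the coboundary of [cochain] with [g] in position [m]. Under a flip the
    constants [al] cancel in each difference of labels and [g] is even, so [sum_faces] applies. *)
Lemma sign_changesD (al : nat -> J -> bool) (s : nat -> gridpt -> 'F_2) m
    (g : gridpt -> 'F_2) :
  (m < N.+1)%N -> (forall i, labelling (al i) (s i)) ->
  labelling (fun=> false) g ->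
  sign_changes (fun i p => if i == m then s i p + g p else s i p) = sign_changes s.
Proof.
move=> mN hs hg.
have psplit f : \prod_(0 <= i < N.+1) f i =
    (\prod_(0 <= i < m) f i) * f m * (\prod_(m.+1 <= i < N.+1) f i) :> 'F_2.
  by rewrite (big_cat_nat (n := m)) ?(ltnW mN) //= [X in _ * X]big_ltn // mulrA.
have Psi0 : \sum_(t : simplex) \sum_(0 <= l < N.+2) cochain N.+1 s g m (vertex t \o bump l) = 0.
  apply: sum_faces => [v v' vv'|v i hv hf].
    rewrite /cochain; congr (_ * _ * _).
    - apply: eq_big_nat => i /andP[_ im]; rewrite !vv' //; lia.
    - by rewrite vv'.
    - apply: eq_big_nat => i /andP[im iN]; rewrite !vv' //; lia.
  have flipE k f a : (k <= N)%N -> labelling a f ->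
      f (flip (blk i) (v k)) = f (v k) + (a (blk i))%:R.
    by move=> kN hf'; apply: hf'; [exact: hv | exists i; last exact: hf].
  have dE k k' j : (k <= N)%N -> (k' <= N)%N ->
      s j (flip (blk i) (v k)) + s j (flip (blk i) (v k')) = s j (v k) + s j (v k').
    by move=> kN kN'; rewrite !(flipE _ _ (al j)) // addrACA addF2 addr0.
  rewrite /cochain /=; congr (_ * _ * _).
  - apply: eq_big_nat => j /andP[_ jm]; rewrite dE //; lia.
  - by rewrite (flipE _ _ (fun=> false)) // addr0.
  - apply: eq_big_nat => j /andP[jm jN]; rewrite dE //; lia.
rewrite -[RHS]addr0 -Psi0 -big_split /=; apply: eq_bigr => t _.
rewrite cochain_coboundary // !psplit eqxx.
set A := \prod_(0 <= i < m) _; set B := \prod_(0 <= i < m) _.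
have <- : A = B by apply: eq_big_nat => i /andP[_ im]; rewrite ltn_eqF.
set C := \prod_(m.+1 <= i < _) _; set D := \prod_(m.+1 <= i < _) _.
have <- : C = D by apply: eq_big_nat => i /andP[im _]; rewrite gtn_eqF.
by rewrite -mulrDl -mulrDr addrACA.
Qed.

Lemma eq_sign_changes (s s' : nat -> gridpt -> 'F_2) :
  (forall i p, (i < N.+1)%N -> s i p = s' i p) -> sign_changes s = sign_changes s'.
Proof.
move=> e; apply: eq_bigr => t _; apply: eq_big_nat => i /andP[_ iN]; rewrite !e //.
Qed.

(** Two labels of the same type differ by an even one, so the labels can be exchanged one at a
    time. *)
Lemma sign_changes_labelling (al : nat -> J -> bool) (s s' : nat -> gridpt -> 'F_2) :
  (forall i, labelling (al i) (s i)) -> (forall i, labelling (al i) (s' i)) ->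
  sign_changes s = sign_changes s'.
Proof.
move=> hs hs'.
pose mix k i p := if (i < k)%N then s' i p else s i p.
have hmix k : (k <= N.+1)%N -> sign_changes (mix k) = sign_changes s.
  elim: k => [_|k IH kN]; first exact: eq_sign_changes.
  rewrite -(IH (ltnW kN)) -(@sign_changesD al (mix k) k (fun p => s k p + s' k p) kN).
  - apply: eq_sign_changes => i p _; rewrite /mix ltnS leq_eqVlt.
    by case: eqP => [->|] //=; rewrite ltnn addrA addF2 add0r.
  - by move=> i j p hp hf; rewrite /mix; case: ifP => _; [exact: hs' | exact: hs].
  - by move=> j p hp hf; rewrite hs // hs' // addrACA addF2.
rewrite -(hmix N.+1) //; apply: eq_sign_changes => i p iN.
by rewrite /mix iN.
Qed.

(** * Lexicographic signs: the sign of the first nonzero coordinate of a block *)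

Definition lexneg (j : J) (p : gridpt) : bool :=
  [exists c, [&& blk c == j, p c < 0 &
     [forall c', (blk c' == j) && (c' < c)%N ==> (p c' == 0)]]].

Lemma lexneg_first j (p : gridpt) c : blk c = j -> p c != 0 ->
  (forall c' : 'I_N.+1, blk c' = j -> (c' < c)%N -> p c' = 0) ->
  lexneg j p = (p c < 0).
Proof.
move=> cj pc hc; apply/existsP/idP => [[c0 /and3P[/eqP c0j pc0 /forallP h]]|pc0].
  case: (ltngtP c0 c) => [lt|gt|/val_inj <-//].
    by rewrite hc // ltxx in pc0.
  by have := h c; rewrite cj eqxx gt (negPf pc).
exists c; rewrite cj eqxx pc0; apply/forallP => c'.
by apply/implyP => /andP[/eqP c'j /hc ->].
Qed.

Lemma lexneg0 j (p : gridpt) : (forall c, blk c = j -> p c = 0) -> lexneg j p = false.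
Proof.
by move=> h; apply/negbTE/existsPn => c; apply/negP => /and3P[/eqP/h ->]; rewrite ltxx.
Qed.

Lemma eq_lexneg j (p p' : gridpt) : (forall c, blk c = j -> p c = p' c) -> lexneg j p = lexneg j p'.
Proof.
move=> h; apply: eq_existsb => c; case: eqP => //= /h ->; congr (_ && _).
by apply: eq_forallb => c'; case: eqP => //= /h ->.
Qed.

Lemma block_min (P : pred 'I_N.+1) (c0 : 'I_N.+1) : P c0 ->
  exists2 c, P c & forall c' : 'I_N.+1, P c' -> (c <= c')%N.
Proof. by move=> Pc0; case: (@arg_minnP _ c0 P (fun i => nat_of_ord i) Pc0) => c; exists c. Qed.

Lemma lexneg_flip j k (p : gridpt) c0 : blk c0 = j -> p c0 != 0 ->
  lexneg k (flip j p) = (k == j) (+) lexneg k p.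
Proof.
move=> c0j pc0; case: (eqVneq k j) => [->|nkj]; last first.
  apply: eq_lexneg => c cj; rewrite ffunE cj (negPf nkj) //.
have [c /andP[/eqP cj pc] cmin] :
    exists2 c, (blk c == j) && (p c != 0) &
      forall c' : 'I_N.+1, (blk c' == j) && (p c' != 0) -> (c <= c')%N.
  by apply: (block_min (P := fun c => (blk c == j) && (p c != 0)) (c0 := c0)); rewrite c0j eqxx.
have hc (c' : 'I_N.+1) : blk c' = j -> (c' < c)%N -> p c' = 0.
  move=> c'j c'c; apply/eqP; apply: contraTT c'c => pc'.
  by rewrite -leqNgt cmin // c'j eqxx.
rewrite (lexneg_first cj pc hc) (lexneg_first (c := c)) //.
- by rewrite ffunE cj eqxx oppr_lt0 /=; case: ltgtP pc.
- by rewrite ffunE cj eqxx oppr_eq0.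
- by move=> c' c'j c'c; rewrite ffunE hc // oppr0 if_same.
Qed.

(** Every symmetry type is realised: on a face of block [j] this block is not zero, so the flip
    reverses its lexicographic sign and leaves the signs of the other blocks alone. *)
Lemma lexneg_labelling (a : pred J) :
  labelling a (fun p => \sum_(j | a j) (lexneg j p)%:R).
Proof.
move=> j p _ [c cj pc].
have p0 : p c != 0 by rewrite -absz_eq0 pc.
under eq_bigr => k ak do rewrite (lexneg_flip k cj p0).
have [aj|naj] := boolP (a j).
  rewrite [LHS](bigD1 j) //= [in RHS](bigD1 j) //= eqxx /=.
  rewrite [in RHS]addrAC; congr (_ + _).
    by case: (lexneg j p); rewrite //= ?addF2 ?add0r.
  by apply: eq_bigr => k /andP[_ /negPf ->].
rewrite addr0; apply: eq_bigr => k ak.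
by rewrite (_ : k == j = false) //; apply: contraNF naj => /eqP <-.
Qed.

(** * Simplices whose signs alternate along a word of blocks *)

Section Words.
Variable w : 'I_N.+1 -> J.

Definition alternating (t : simplex) :=
  [forall m : 'I_N.+1, lexneg (w m) (vertex t m.+1) != lexneg (w m) (vertex t m)].

Let cnt (c : 'I_N.+1) := #|[set c' : 'I_N.+1 | (blk c' == blk c) && (c <= c')%N]|.
Let cnt' (c : 'I_N.+1) := #|[set c' : 'I_N.+1 | (blk c' == blk c) && (c < c')%N]|.

Let cntE c : cnt c = (cnt' c).+1.
Proof.
rewrite /cnt (cardsD1 c) inE eqxx leqnn add1n; congr _.+1.
apply: eq_card => x; rewrite !inE ltn_neqAle andbCA; congr (_ && _).
by rewrite eq_sym.
Qed.

(** The successor of [c] in its block decides the sign, and its [cnt] equals [cnt' c]. Without a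
    successor the block vanishes and both sides are false. *)
Let lexneg_tail (p : gridpt) c :
  (forall c' : 'I_N.+1, blk c' = blk c -> (c' <= c)%N -> p c' = 0) ->
  (forall c' : 'I_N.+1, blk c' = blk c -> (c < c')%N -> p c' != 0 /\ (p c' < 0) = odd (cnt c')) ->
  lexneg (blk c) p = odd (cnt' c).
Proof.
move=> h0 h1.
have [[c0 /andP[/eqP c0c cc0]]|none] :=
    pselect (exists c0 : 'I_N.+1, (blk c0 == blk c) && (c < c0)%N); last first.
  have out c' : blk c' = blk c -> (c' <= c)%N.
    by move=> e; rewrite leqNgt; apply/negP => lt; apply: none; exists c'; rewrite e eqxx.
  rewrite lexneg0; last by move=> c' e; rewrite h0 ?out.
  rewrite /cnt' (_ : [set _ | _] = finset.set0) ?cards0 //.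
  by apply/setP => c'; rewrite !inE; apply/negP => /andP[/eqP/out]; rewrite leqNgt => /negP.
have [c1 /andP[/eqP c1c cc1] c1min] :
    exists2 c1, (blk c1 == blk c) && (c < c1)%N &
      forall c' : 'I_N.+1, (blk c' == blk c) && (c < c')%N -> (c1 <= c')%N.
  by apply: (block_min (P := fun c1 => (blk c1 == blk c) && (c < c1)%N) (c0 := c0)); rewrite c0c eqxx.
have [p1 p1e] := h1 _ c1c cc1.
rewrite (lexneg_first c1c p1); last first.
  move=> c' c'c c'c1; apply: h0 => //; rewrite leqNgt; apply/negP => lt.
  by have := c1min c'; rewrite c'c eqxx lt leqNgt c'c1 => /(_ isT).
rewrite p1e; congr odd; apply: eq_card => x; rewrite !inE c1c.
case: eqP => //= xc; apply/idP/idP => [|lt]; first exact: leq_trans.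
by apply: c1min; rewrite xc eqxx.
Qed.

Let vertex_lt0 t l i : (vertex t l i < 0) = t.1.1 i && (vertex t l i != 0).
Proof. rewrite ffunE; case: (t.1.1 i); rewrite ?expr1 ?expr0 /=; lia. Qed.

Let vertex_eq0 t l i : (vertex t l i == 0) = (t.1.2 i == ord0) && (l <= t.2 i)%N.
Proof.
by rewrite ffunE mulf_eq0 signr_eq0 /= -val_eqE /= [(l <= _)%N]leqNgt; case: (t.2 i < l)%N => /=; lia.
Qed.

(** A move reverses the sign of a block only if the moving coordinate lies in the block and no
    coordinate up to it has left 0. Hence the simplex starts at the origin, each block moves its
    coordinates from the last to the first, and their signs alternate. *)
Lemma alternatingP (t : simplex) : reflect
  [/\ forall c, w (t.2 c) = blk c,
      forall c c' : 'I_N.+1, blk c' = blk c -> (c' < c)%N -> (t.2 c < t.2 c')%N,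
      t.1.2 = [ffun=> ord0] & t.1.1 = [ffun c => odd (cnt c)]]
  (alternating t).
Proof.
have later (c c' : 'I_N.+1) : c != c' -> (t.2 c' < (t.2 c).+1)%N = (t.2 c' < t.2 c)%N.
  move=> ne; rewrite ltnS leq_eqVlt; case: eqP => // /val_inj/perm_inj e.
  by rewrite e eqxx in ne.
have step (c c' : 'I_N.+1) : c != c' -> vertex t (t.2 c).+1 c' = vertex t (t.2 c) c'.
  by move=> /later e; rewrite !ffunE e.
have step0 c : vertex t (t.2 c).+1 c != 0.
  by rewrite vertex_eq0 ltnn andbF.
apply: (iffP forallP) => [alt|[hw hr hy he] m].
  have hw c : w (t.2 c) = blk c.
    apply/eqP; apply: contraTT (alt (t.2 c)) => ne; rewrite negbK.
    apply/eqP/eq_lexneg => c' c'w; rewrite step //.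
    by apply: contraNneq ne => e; rewrite -c'w e.
  (* Otherwise the first nonzero coordinate of the block up to [c] would decide the sign both before
     and after the move, and a move never reverses the sign of a nonzero coordinate. *)
  have hz (c c' : 'I_N.+1) : blk c' = blk c -> (c' <= c)%N -> vertex t (t.2 c) c' = 0.
    move=> c'c le; apply/eqP; apply: contraT => nz.
    have [c1 /and3P[/eqP c1c c1le c1z] c1min] :
      exists2 c1, [&& blk c1 == blk c, (c1 <= c)%N & vertex t (t.2 c) c1 != 0] &
      forall c' : 'I_N.+1, [&& blk c' == blk c, (c' <= c)%N & vertex t (t.2 c) c' != 0] ->
        (c1 <= c')%N.
      apply: (block_min (P := fun c1 => [&& blk c1 == blk c, (c1 <= c)%N & _ c1 != 0]) (c0 := c')).
      by rewrite c'c eqxx le.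
    have lo (c2 : 'I_N.+1) : blk c2 = blk c -> (c2 < c1)%N -> vertex t (t.2 c) c2 = 0.
      move=> c2c lt; apply/eqP; apply: contraT => c2z.
      by have := c1min c2; rewrite c2c eqxx c2z (ltnW (leq_trans lt c1le)) leqNgt lt => /(_ isT).
    have nz1 : vertex t (t.2 c).+1 c1 != 0.
      by case: (eqVneq c c1) => [<-|/step ->].
    have := alt (t.2 c); rewrite hw.
    rewrite (lexneg_first c1c c1z lo) (lexneg_first c1c nz1); last first.
      move=> c2 c2c lt; rewrite step ?lo //.
      by apply: contraTneq lt => <-; rewrite -leqNgt.
    by rewrite !vertex_lt0 c1z nz1 eqxx.
  have hy : t.1.2 = [ffun=> ord0].
    apply/ffunP => c; rewrite ffunE; have /eqP := hz c c erefl (leqnn _).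
    by rewrite vertex_eq0 => /andP[/eqP].
  have hr (c c' : 'I_N.+1) : blk c' = blk c -> (c' < c)%N -> (t.2 c < t.2 c')%N.
    move=> c'c lt; have /eqP := hz c c' c'c (ltnW lt); rewrite vertex_eq0 => /andP[_].
    rewrite leq_eqVlt => /orP[/eqP/val_inj/perm_inj e|//].
    by rewrite e ltnn in lt.
  split=> //; apply/ffunP => c; rewrite ffunE.
  (* Induction from the end of the block: the signs of later coordinates fix the sign of the block
     before [c] moves, and the move must reverse it. *)
  have [n le_n] := ubnP (N - c)%N; elim: n c le_n => // n IH c le_n.
  have := alt (t.2 c); rewrite hw (lexneg_first erefl (step0 c)); last first.
    move=> c' c'c lt; rewrite step ?hz // ?(ltnW lt) //.
    by apply: contraTneq lt => ->; rewrite ltnn.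
  rewrite lexneg_tail; last 2 first.
  - by move=> c' c'c le; rewrite hz.
  - move=> c' c'c lt.
    have nz : vertex t (t.2 c) c' != 0 by rewrite vertex_eq0 negb_and -ltnNge hr ?orbT.
    rewrite nz vertex_lt0 nz andbT IH //.
    by have := ltn_ord c'; lia.
  by rewrite vertex_lt0 step0 andbT cntE /=; case: (t.1.1 c); case: (odd (cnt' c)).
set c := (t.2^-1)%g m; have mE : m = t.2 c by rewrite permKV.
have z (c' : 'I_N.+1) : blk c' = blk c -> (c' <= c)%N -> vertex t m c' = 0.
  move=> c'c le; apply/eqP; rewrite vertex_eq0 hy ffunE eqxx mE /=.
  by move: le; rewrite leq_eqVlt => /orP[/eqP/val_inj ->//|lt]; rewrite ltnW ?hr.
rewrite [w m](_ : _ = blk c) ?mE ?hw // (lexneg_first erefl (step0 c)); last first.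
  move=> c' c'c lt; rewrite step -?mE ?z // ?(ltnW lt) //.
  by apply: contraTneq lt => ->; rewrite ltnn.
rewrite -mE lexneg_tail //; last first.
  move=> c' c'c lt.
  have nz : vertex t m c' != 0 by rewrite vertex_eq0 mE negb_and -ltnNge hr ?orbT.
  by rewrite nz vertex_lt0 nz andbT he ffunE.
by rewrite vertex_lt0 mE step0 andbT he ffunE cntE /=; case: (odd _).
Qed.

End Words.
Lemma perm_block_increasing (p : {perm 'I_N.+1}) :
  (forall c, blk (p c) = blk c) ->
  (forall c c' : 'I_N.+1, blk c = blk c' -> (c < c')%N -> (p c < p c')%N) -> p = 1%g.
Proof.
move=> pb pm; apply/permP => c; rewrite perm1.
have [n] := ubnP (val c); elim: n c => // n IH c; rewrite ltnS => cn.
apply/eqP; case: (ltngtP (p c) c) => [lt|gt|/val_inj ->//].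
  have /perm_inj e := IH (p c) (leq_trans lt cn).
  by rewrite e ltnn in lt.
pose c' := (p^-1)%g c; have pc' : p c' = c by rewrite permKV.
have bc' : blk c' = blk c by rewrite -pc' pb.
case: (ltngtP c' c) => [lt|gt'|/val_inj e].
- have := IH c' (leq_trans lt cn); rewrite pc' => e; by rewrite -e ltnn in lt.
- by have := pm c c' (esym bc') gt'; rewrite pc' ltnNge (ltnW gt).
- by move: gt; rewrite -[X in p X]e pc' ltnn.
Qed.

Definition fits (w : 'I_N.+1 -> J) :=
  [forall j, #|[set m | w m == j]| == #|[set i | blk i == j]|].

Lemma sorted_enum_ltn (A : {set 'I_N.+1}) : sorted (fun x y : 'I_N.+1 => (x < y)%N) (enum A).
Proof.
have tr : transitive (fun x y : 'I_N.+1 => (x < y)%N) by move=> x y z; exact: ltn_trans.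
rewrite {1}/enum_mem; apply: sorted_filter => //.
have := iota_ltn_sorted 0 N.+1; rewrite -val_enum_ord sorted_map.
by rewrite enumT.
Qed.

(** The positions of a block in [w], in increasing order, are assigned to its coordinates from the
    last to the first; [k c] counts the coordinates served before [c]. *)
Lemma decreasing_shuffle (w : 'I_N.+1 -> J) : fits w ->
  exists r : {perm 'I_N.+1}, (forall c, w (r c) = blk c) /\
    forall c c' : 'I_N.+1, blk c' = blk c -> (c' < c)%N -> (r c < r c')%N.
Proof.
move=> /forallP fw.
pose k (c : 'I_N.+1) := #|[set c' : 'I_N.+1 | (blk c' == blk c) && (c < c')%N]|.
pose A (c : 'I_N.+1) := [set m | w m == blk c].
have kA c : (k c < size (enum (A c)))%N.
  rewrite -cardE /A (eqP (fw _)) (cardsD1 c) inE eqxx /= add1n ltnS subset_leq_card //.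
  apply/fintype.subsetP => x; rewrite !inE => /andP[-> lt]; rewrite andbT.
  by apply: contraTneq lt => ->; rewrite ltnn.
pose f c := nth ord0 (enum (A c)) (k c).
have fA c : w (f c) = blk c.
  by have := mem_nth ord0 (kA c); rewrite mem_enum inE => /eqP.
have kdec (c c' : 'I_N.+1) : blk c' = blk c -> (c' < c)%N -> (k c < k c')%N.
  move=> e lt; rewrite [X in (_ < X)%N](cardsD1 c) inE e eqxx lt /= add1n ltnS subset_leq_card //.
  apply/fintype.subsetP => x; rewrite !inE => /andP[/eqP -> lt'].
  rewrite eqxx (ltn_trans lt lt') !andbT /=.
  by apply: contraTneq lt' => ->; rewrite ltnn.
have fdec (c c' : 'I_N.+1) : blk c' = blk c -> (c' < c)%N -> (f c < f c')%N.
  move=> e lt; have kA' := kA c'.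
  have Ae : A c' = A c by rewrite /A e.
  rewrite /f Ae in kA' *.
  apply: (sorted_ltn_nth _ _ (sorted_enum_ltn (A c))); rewrite ?inE ?kA' ?kA ?kdec //.
  by move=> x y z; exact: ltn_trans.
have finj : injective f.
  move=> c c' e; have bc : blk c = blk c' by rewrite -!fA e.
  case: (ltngtP c c') => [lt|lt|/val_inj //].
    by have := fdec c' c bc lt; rewrite e ltnn.
  by have := fdec c c' (esym bc) lt; rewrite e ltnn.
exists (perm finj); split=> [c|c c' e lt]; rewrite !permE //; exact: fdec.
Qed.

Lemma shuffle_uniq (w : 'I_N.+1 -> J) (r r' : {perm 'I_N.+1}) :
  (forall c, w (r c) = blk c) -> (forall c, w (r' c) = blk c) ->
  (forall c c' : 'I_N.+1, blk c' = blk c -> (c' < c)%N -> (r c < r c')%N) ->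
  (forall c c' : 'I_N.+1, blk c' = blk c -> (c' < c)%N -> (r' c < r' c')%N) ->
  r = r'.
Proof.
move=> rw r'w rd r'd.
have e c : r' ((r * r'^-1)%g c) = r c by rewrite permM permKV.
have b c : blk ((r * r'^-1)%g c) = blk c by rewrite -r'w e rw.
suff : (r * r'^-1 = 1)%g by move/(congr1 (fun p => p * r')%g); rewrite mulgKV mul1g.
apply: perm_block_increasing => // c c' bc lt.
case: ltngtP => // [gt|/val_inj/perm_inj ee]; last by rewrite ee ltnn in lt.
have := r'd _ _ _ gt; rewrite !b !e bc => /(_ erefl).
by rewrite ltnNge ltnW // rd.
Qed.

(** By [alternatingP] the word determines orthant, starting point and order of moves, so at most one
    simplex alternates; it exists exactly when each block has as many positions in the word as
    coordinates. *)
Lemma sum_alternating (w : 'I_N.+1 -> J) :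
  \sum_(t : simplex) (alternating w t)%:R = (fits w)%:R :> 'F_2.
Proof.
have [fw|nfw] := boolP (fits w); last first.
  rewrite big1 // => t _; case: alternatingP => // -[tw _ _ _].
  case/negP: nfw; apply/forallP => j.
  apply/eqP; rewrite -[RHS](card_imset _ (@perm_inj _ t.2)); apply: eq_card => m.
  rewrite inE; apply/idP/finset.imsetP => [/eqP <-|[c]]; last first.
    by rewrite inE => /eqP <- ->; rewrite tw.
  by exists ((t.2^-1)%g m); rewrite ?inE ?permKV // -tw permKV.
have [r [rw rd]] := decreasing_shuffle fw.
pose t0 : simplex := ([ffun c : 'I_N.+1 => odd #|[set c' : 'I_N.+1 | (blk c' == blk c) && (c <= c')%N]|],
  [ffun=> ord0], r).
rewrite (bigD1 t0) //= big1 ?addr0.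
  by case: alternatingP => // -[].
move=> t nt; case: alternatingP => // -[tw td ty te].
case/eqP: nt; rewrite (surjective_pairing t) (surjective_pairing t.1) te ty.
by rewrite (shuffle_uniq tw rw).
Qed.

(* By invariance the labels may be taken to be sums of the signs lexneg j; the
   count then expands into a sum over the choices w of one block per label. *)
Lemma sign_changes_words (al : nat -> pred J) (s : nat -> gridpt -> 'F_2) :
  (forall i, labelling (al i) (s i)) ->
  sign_changes s =
  \sum_(w : {ffun 'I_N.+1 -> J} | [forall m : 'I_N.+1, al m (w m)]) (fits w)%:R.
Proof.
move=> hs; rewrite (sign_changes_labelling hs (fun i => lexneg_labelling (al i))).
transitivity (\sum_(t : simplex) \sum_(w : {ffun 'I_N.+1 -> J} | [forall m : 'I_N.+1, al m (w m)])
    (alternating w t)%:R : 'F_2); last first.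
  by rewrite exchange_big /=; apply: eq_bigr => w _; exact: sum_alternating.
apply: eq_bigr => t _; rewrite big_mkord.
under eq_bigr => m _ do rewrite -big_split /=.
rewrite bigA_distr_big_dep /=; apply: eq_big => [w|w _].
  by apply/familyP/forallP => h m; exact: h.
rewrite -(_ : \prod_(m < N.+1) (lexneg (w m) (vertex t m.+1) != lexneg (w m) (vertex t m))%:R =
  (alternating w t)%:R).
  by apply: eq_bigr => m _; case: (lexneg _ _); case: (lexneg _ _); rewrite ?addF2 ?addr0 ?add0r.
have [/fintype.forallP h|] := boolP (alternating w t).
  by rewrite big1 // => m _; rewrite h.
by rewrite /alternating negb_forall => /existsP[m /negPf h]; rewrite (bigD1 m) //= h mul0r.
Qed.

End Freudenthal.
Local Open Scope classical_set_scope.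
Local Open Scope ring_scope.

(** * A Borsuk-Ulam theorem for products of discs *)

Section BorsukUlam.
Variables (R : realType) (N : nat) (J : finType) (blk : 'I_N.+1 -> J).

Definition flip_row (j : J) (x : 'rV[R]_N.+1) : 'rV[R]_N.+1 :=
  \row_i (if blk i == j then - x 0 i else x 0 i).

Definition grid_row (M : nat) (p : gridpt N) : 'rV[R]_N.+1 :=
  \row_i ((p i)%:~R / M.+1%:R).

Lemma grid_row_flip M j p : grid_row M (flip blk j p) = flip_row j (grid_row M p).
Proof.
apply/rowP => i; rewrite !mxE ffunE.
by case: ifP => // _; rewrite rmorphN /= mulNr.
Qed.

Lemma norm_grid_row M p i : `|grid_row M p 0 i| = `|p i|%N%:R / M.+1%:R.
Proof.
by rewrite mxE normrM normfV (ger0_norm (ler0n R M.+1)) -intr_norm; congr (_ / _).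
Qed.

Lemma grid_row_vertex_dist M (t : simplex N M) k i :
  `|grid_row M (vertex t k) 0 i - grid_row M (vertex t 0) 0 i| <= M.+1%:R^-1.
Proof.
rewrite !mxE !ffunE /= -mulrBl normrM normfV (ger0_norm (ler0n R M.+1)).
rewrite ler_piMl // -rmorphB /= -mulrBr.
rewrite -intr_norm normrM normr_sign mul1r addn0 addnC PoszD addrK.
by case: (_ < k)%N; rewrite /= ?normr0 ?normr1.
Qed.

Variables (al : 'I_N.+1 -> pred J) (f : 'I_N.+1 -> 'rV[R]_N.+1 -> R).
Hypothesis f_cont : forall m, continuous (f m).
Hypothesis f_flip : forall m j (x : 'rV[R]_N.+1),
  (forall i, `|x 0 i| <= 1) -> (exists2 i, blk i = j & `|x 0 i| = 1) ->
  f m (flip_row j x) = (-1) ^+ (al m j) * f m x.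
Hypothesis odd_words :
  \sum_(w : {ffun 'I_N.+1 -> J} | [forall m : 'I_N.+1, al m (w m)])
    (fits blk w)%:R = 1 :> 'F_2.

(** The count is 1 mod 2, so some simplex contributes: on its edge from vertex [m] to [m.+1] the
    label [m] changes, which excludes two values of [f m] with the same strict sign. *)
Lemma exists_sign_change_simplex M : exists t : simplex N M, forall m,
  f m (grid_row M (vertex t m)) * f m (grid_row M (vertex t m.+1)) <= 0.
Proof.
pose al' i := al (inord i).
(* Where a test vanishes it has no sign; a lexicographic label of the same symmetry type takes its
   place, so that [s i] is still a labelling. *)
pose s i p : 'F_2 := let z := f (inord i) (grid_row M p) in
  if z == 0 then \sum_(j | al' i j) (lexneg blk j p)%:R else (z < 0)%R%:R.
have hs i : labelling M blk (al' i) (s i).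
  move=> j p pin pf; rewrite /s grid_row_flip f_flip; first last.
  - case: pf => c cj pc; exists c => //.
    by rewrite norm_grid_row pc divff // pnatr_eq0.
  - move=> c; rewrite norm_grid_row ler_pdivrMr ?ltr0n // mul1r ler_nat.
    exact: pin.
  rewrite mulf_eq0 signr_eq0 /=; case: eqP => [_|/eqP z0].
    exact: (@lexneg_labelling N M).
  rewrite /al'; case: (al _ j) => /=; rewrite ?mul1r ?addr0 // mulN1r oppr_lt0.
  by case: ltgtP z0; rewrite //= ?addF2 ?add0r.
have := sign_changes_words hs.
rewrite (_ : (\sum_(w | _) _) = 1); last first.
  rewrite -[RHS]odd_words; apply: eq_bigl => w.
  by apply: eq_forallb => m; rewrite /al' inord_val.
move=> S1.
have [t tP] : exists t : simplex N M,
    \prod_(0 <= i < N.+1) (s i (vertex t i.+1) + s i (vertex t i)) != 0.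
  apply/existsP; apply: contraT; rewrite negb_exists => /fintype.forallP h.
  have := oner_neq0 'F_2; rewrite -S1 /sign_changes big1 ?eqxx // => t _.
  by have := h t; rewrite negbK => /eqP.
exists t => m; rewrite leNgt; apply/negP => pos.
move/negP: tP; apply; rewrite big_mkord (bigD1 m) //= mulf_eq0; apply/orP; left.
rewrite /s inord_val; move: pos.
set a := f m _; set b := f m _ => ab.
have a0 : a == 0 = false by apply: contraTF ab => /eqP ->; rewrite mul0r ltxx.
have b0 : b == 0 = false by apply: contraTF ab => /eqP ->; rewrite mulr0 ltxx.
rewrite a0 b0 (_ : (a < 0) = (b < 0)) ?addF2 //.
by apply/idP/idP => h; move: ab; [rewrite nmulr_rgt0 | rewrite nmulr_lgt0].
Qed.

(** The base vertices for finer and finer grids cluster at some [x]. If [f m x] were nonzero, [f m]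
    would keep its sign on all vertices of a small simplex near [x], against the sign change
    there. *)
Theorem borsuk_ulam_blocks : exists x : 'rV[R]_N.+1, forall m, f m x = 0.
Proof.
have /choice[v vP] : forall M, exists v : nat -> gridpt N,
    (exists t : simplex N M, v = vertex t) /\
    forall m, f m (grid_row M (v m)) * f m (grid_row M (v m.+1)) <= 0.
  by move=> M; have [t tP] := exists_sign_change_simplex M; exists (vertex t); split=> //; exists t.
pose x_ M := grid_row M (v M 0%N).
have x_cube M i : `|x_ M 0 i| <= 1.
  rewrite norm_grid_row ler_pdivrMr ?ltr0n // mul1r ler_nat.
  have [[t ->] _] := vP M; exact: vertex_in_grid.
have cK : compact [set v : 'rV[R]_N.+1 | forall i, `[-1, 1]%classic (v ord0 i)].
  by apply (@rV_compact R N.+1 (fun=> `[-1, 1]%classic)) => i; exact: segment_compact.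
have [x xcl] : exists x : 'rV[R]_N.+1, cluster (x_ @ \oo) x.
  have [|x [_ xcl]] := cK (x_ @ \oo) _; last by exists x.
  by exists 0%N => // M _ i /=; rewrite in_itv /= -ler_norml.
exists x => m; apply/eqP; apply: contraT => fx0.
have : \forall z \near x, `|f m x - f m z| < `|f m x|.
  by have /cvgrPdist_lt := @f_cont m x; apply; rewrite normr_gt0.
move=> /nbhs_ballP[e /= e0 he].
have same_sign (a b : R) : `|a - b| < `|a| -> 0 < b * a.
  rewrite ltr_norml => /andP[ab1 ab2].
  by case: (lerP 0 a) => a0; [rewrite ger0_norm // in ab1 ab2 | rewrite ltr0_norm // in ab1 ab2]; nra.
have big : \forall M \near \oo, M.+1%:R^-1 < e / 2 :> R.
  by apply: near_infty_natSinv_lt (PosNum (divr_gt0 e0 (ltr0n R 2))).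
have [] := xcl [set y | exists M, y = x_ M /\ M.+1%:R^-1 < e / 2] (ball x (e / 2)).
- by case: big => n _ hn; exists n => // M /hn; exists M.
- by apply: nbhsx_ballx; rewrite divr_gt0.
move=> _ [[M [-> Me]] xM].
have pos k : 0 < f m (grid_row M (v M k)) * f m x.
  have [[t vE] _] := vP M.
  apply: same_sign; apply: he; rewrite [e]splitr; apply: (ball_triangle xM).
  split=> [|i j]; first by rewrite divr_gt0.
  rewrite /ball /= (ord1 i) distrC.
  rewrite /x_ vE; exact: le_lt_trans (grid_row_vertex_dist _ _ _) Me.
have := (vP M).2 m; rewrite leNgt => /negP; case.
have := mulr_gt0 (pos m) (pos m.+1); rewrite mulrACA.
by rewrite pmulr_lgt0 // -expr2 exprn_even_gt0.
Qed.

End BorsukUlam.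

(** * Squares and coefficients of polynomials in four variables over F_2 *)

Section FrobeniusCoefficients.
Variable A : comNzRingType.
Hypothesis char2 : forall x : A, x + x = 0.

Lemma addrr_poly2 (p : {poly A}) : p + p = 0.
Proof. by apply/polyP => i; rewrite coefD coef0. Qed.

Lemma coef_sqr_poly2 (p : {poly A}) i :
  (p ^+ 2)`_i = if odd i then 0 else p`_(i./2) ^+ 2.
Proof.
elim/poly_ind: p i => [|p c IH] i.
  by rewrite expr0n /= !coef0 expr0n; case: ifP.
rewrite sqrrD mulr2n addrr_poly2 addr0 exprMn -polyC_exp coefD coefMXn coefC IH.
case: i => [|[|i]] /=; rewrite ?addr0 ?add0r //.
  by rewrite coefD coefMX coefC /= add0r.
rewrite subn2 /= negbK; case: ifP => // _.
by rewrite coefD coefMX coefC /= addr0.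
Qed.

End FrobeniusCoefficients.

(** Variable 0 is the outermost one, and [coef4] reads the coefficients from the outside in. *)
Definition poly4 : comNzRingType := {poly {poly {poly {poly 'F_2}}}}.

Definition coef4 (p : poly4) (x : nat * nat * nat * nat) : 'F_2 :=
  p`_x.1.1.1`_x.1.1.2`_x.1.2`_x.2.

Definition var4 (j : nat) : poly4 :=
  match j with
  | 0 => 'X
  | 1 => 'X%:P
  | 2 => 'X%:P%:P
  | _ => 'X%:P%:P%:P
  end.

Definition mono4 (e : nat * nat * nat * nat) : poly4 :=
  var4 0 ^+ e.1.1.1 * (var4 1 ^+ e.1.1.2 * (var4 2 ^+ e.1.2 * var4 3 ^+ e.2)).

Lemma coef4D p q x : coef4 (p + q) x = coef4 p x + coef4 q x.
Proof. by rewrite /coef4 !coefD. Qed.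

Lemma coef40 x : coef4 0 x = 0.
Proof. by rewrite /coef4 !coef0. Qed.

Definition le4 (e x : nat * nat * nat * nat) :=
  [&& e.1.1.1 <= x.1.1.1, e.1.1.2 <= x.1.1.2, e.1.2 <= x.1.2 & e.2 <= x.2]%N.

Definition sub4 (x e : nat * nat * nat * nat) :=
  (x.1.1.1 - e.1.1.1, x.1.1.2 - e.1.1.2, x.1.2 - e.1.2, x.2 - e.2)%N.

Definition add4 (x e : nat * nat * nat * nat) :=
  (x.1.1.1 + e.1.1.1, x.1.1.2 + e.1.1.2, x.1.2 + e.1.2, x.2 + e.2)%N.

Lemma coef4_monoM e p x :
  coef4 (mono4 e * p) x = if le4 e x then coef4 p (sub4 x e) else 0.
Proof.
case: e => [[[e0 e1] e2] e3]; case: x => [[[x0 x1] x2] x3].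
rewrite /mono4 /le4 /sub4 /coef4 /= -!polyC_exp -!mulrA.
rewrite coefXnM; case: ltnP => h0 /=; first by rewrite !coef0.
rewrite coefCM coefXnM; case: ltnP => h1 /=; first by rewrite !coef0.
rewrite !coefCM coefXnM; case: ltnP => h2 /=; first by rewrite !coef0.
by rewrite !coefCM coefXnM; case: ltnP.
Qed.

Definition half4 (e : nat * nat * nat * nat) :=
  (e.1.1.1./2, e.1.1.2./2, e.1.2./2, e.2./2)%N.

Definition even4 (e : nat * nat * nat * nat) :=
  [&& ~~ odd e.1.1.1, ~~ odd e.1.1.2, ~~ odd e.1.2 & ~~ odd e.2].

Lemma coef4_sqr p x : coef4 (p ^+ 2) x = if even4 x then coef4 p (half4 x) else 0.
Proof.
have h1 := addF2; have h2 := addrr_poly2 h1; have h3 := addrr_poly2 h2.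
have h4 := addrr_poly2 h3.
case: x => [[[x0 x1] x2] x3]; rewrite /even4 /half4 /coef4 /=.
rewrite coef_sqr_poly2 //; case: ifP => _ /=; first by rewrite !coef0.
rewrite coef_sqr_poly2 //; case: ifP => _ /=; first by rewrite !coef0.
rewrite coef_sqr_poly2 //; case: ifP => _ /=; first by rewrite !coef0.
rewrite coef_sqr_poly2 //; case: ifP => _ //=.
by case: (_`_(x3./2)) => -[|[|//]] h; apply: val_inj.
Qed.

(* A polynomial over F_2 is represented by the list of its monomials, kept
   sorted so that equal polynomials are equal lists. *)
Definition sparse4 := seq (nat * nat * nat * nat).

Definition eval4 (l : sparse4) : poly4 := \sum_(e <- l) mono4 e.

Lemma eval4_cons e l : eval4 (e :: l) = mono4 e + eval4 l.
Proof. exact: big_cons. Qed.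

(** The component of the Cartier operator at residue 0, for the prime 2. *)
Definition cartier (l : sparse4) : sparse4 := [seq half4 e | e <- l & even4 e].

(** All exponents of a square in characteristic 2 are even, so only the even monomials of [l] reach
    an even exponent, and there all exponents can be halved. *)
Lemma coef4_cartier l p x :
  coef4 (eval4 l * p ^+ 2) (add4 x x) = coef4 (eval4 (cartier l) * p) x.
Proof.
rewrite /eval4 /cartier; elim: l => [|e l IH]; first by rewrite !big_nil !mul0r !coef40.
rewrite big_cons mulrDl coef4D {}IH coef4_monoM coef4_sqr /=.
set c := coef4 (_ * p) x.
have c_ev : le4 e (add4 x x) -> even4 (sub4 (add4 x x) e) = even4 e.
  case: e @c => [[[e0 e1] e2] e3] _; case: x => [[[x0 x1] x2] x3].
  rewrite /even4 /le4 /sub4 /add4 /= => /and4P[h0 h1 h2 h3].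
  by rewrite !oddB // !addnn !odd_double.
have [ee|/negPf nee] := boolP (even4 e); last first.
  by case: ifP => le; rewrite ?c_ev ?nee ?add0r.
rewrite [map _ _]/= big_cons mulrDl coef4D -/c; congr (_ + _); rewrite coef4_monoM.
have -> : le4 e (add4 x x) = le4 (half4 e) x.
  case: e ee {c c_ev} => [[[e0 e1] e2] e3]; case: x => [[[x0 x1] x2] x3].
  rewrite /even4 /le4 /half4 /add4 /= => /and4P[h0 h1 h2 h3]; lia.
case: ifP => // le; rewrite c_ev; last first.
  case: e ee le {c c_ev} => [[[e0 e1] e2] e3]; case: x => [[[x0 x1] x2] x3].
  rewrite /even4 /le4 /half4 /add4 /= => /and4P[h0 h1 h2 h3]; lia.
rewrite ee; congr coef4.
case: e ee le {c c_ev} => [[[e0 e1] e2] e3]; case: x => [[[x0 x1] x2] x3].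
rewrite /even4 /le4 /half4 /add4 /sub4 /= => /and4P[h0 h1 h2 h3] _.
congr (_, _, _, _); lia.
Qed.

Fixpoint lt_lex (s t : seq nat) : bool :=
  match s, t with
  | a :: s', b :: t' => if (a == b)%N then lt_lex s' t' else (a < b)%N
  | _, _ => false
  end.

Definition lt4 (e f : nat * nat * nat * nat) :=
  lt_lex [:: e.1.1.1; e.1.1.2; e.1.2; e.2] [:: f.1.1.1; f.1.1.2; f.1.2; f.2].

(** Addition over F_2 as the merge of two sorted lists: equal heads meet and cancel. *)
Fixpoint merge_xor (l : sparse4) : sparse4 -> sparse4 :=
  fix aux (r : sparse4) : sparse4 :=
    match l, r with
    | [::], _ => r
    | _, [::] => l
    | e :: l', f :: r' =>
        if e == f then merge_xor l' r'
        else if lt4 e f then e :: merge_xor l' r else f :: aux r'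
    end.

Lemma eval4_merge_xor l r : eval4 (merge_xor l r) = eval4 l + eval4 r.
Proof.
have h4 := addrr_poly2 (addrr_poly2 (addrr_poly2 (addrr_poly2 addF2))).
elim: l r => [|e l IHl] r; first by case: r => [|f r]; rewrite /eval4 /= big_nil ?add0r.
elim: r => [|f r IHr]; first by rewrite /eval4 /= big_nil addr0.
rewrite (_ : merge_xor (e :: l) (f :: r) =
  if e == f then merge_xor l r
  else if lt4 e f then e :: merge_xor l (f :: r) else f :: merge_xor (e :: l) r) //.
case: eqP => [<-|_].
  by rewrite IHl !eval4_cons addrACA h4 add0r.
case: ifP => _; rewrite !eval4_cons; first by rewrite IHl eval4_cons addrA.
by rewrite IHr eval4_cons addrCA.
Qed.

Definition incr4 (j : nat) (e : nat * nat * nat * nat) :=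
  match j with
  | 0 => (e.1.1.1.+1, e.1.1.2, e.1.2, e.2)
  | 1 => (e.1.1.1, e.1.1.2.+1, e.1.2, e.2)
  | 2 => (e.1.1.1, e.1.1.2, e.1.2.+1, e.2)
  | _ => (e.1.1.1, e.1.1.2, e.1.2, e.2.+1)
  end.

Definition mul_form (l : sparse4) (T : seq nat) : sparse4 :=
  foldr (fun j r => merge_xor (map (incr4 j) l) r) [::] T.

Definition form4 (T : seq nat) : poly4 := \sum_(j <- T) var4 j.

Lemma mono4_incr j e : mono4 (incr4 j e) = mono4 e * var4 j.
Proof. by case: j => [|[|[|j]]]; rewrite /mono4 /= exprSr; ring. Qed.

Lemma eval4_mul_form l T : eval4 (mul_form l T) = eval4 l * form4 T.
Proof.
rewrite /form4; elim: T => [|j T IH]; first by rewrite big_nil mulr0 /eval4 big_nil.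
rewrite big_cons mulrDr /= eval4_merge_xor IH; congr (_ + _).
rewrite /eval4 big_map mulr_suml; apply: eq_bigr => e _; exact: mono4_incr.
Qed.

Definition mul_forms (l : sparse4) (Ts : seq (seq nat)) : sparse4 := foldl mul_form l Ts.

Lemma eval4_mul_forms l Ts : eval4 (mul_forms l Ts) = eval4 l * \prod_(T <- Ts) form4 T.
Proof.
elim: Ts l => [|T Ts IH] l; first by rewrite big_nil mulr1.
by rewrite /= IH eval4_mul_form big_cons mulrA.
Qed.

(** * The linear forms of the tests and the finite set of states *)

Definition forms_le3 : seq (seq nat) :=
  [:: [:: 0; 1; 2]; [:: 0; 1; 3]; [:: 0; 2; 3]; [:: 1; 2; 3];
      [:: 0; 1]; [:: 0; 2]; [:: 0; 3]; [:: 1; 2]; [:: 1; 3]; [:: 2; 3];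
      [:: 0]; [:: 1]; [:: 2]; [:: 3]]%N.

Definition forms_le2 : seq (seq nat) :=
  [:: [:: 1; 2]; [:: 1; 3]; [:: 2; 3]; [:: 1]; [:: 2]; [:: 3]]%N.

Definition forms_pairs : seq (seq nat) :=
  [:: [:: 0; 1]; [:: 0; 2]; [:: 0; 3]; [:: 1; 2]; [:: 1; 3]; [:: 2; 3]]%N.

(** The types of the six zero tests. They bring the number of forms to 14(2^(q+1) - t) + 6(t - 2) +
    6 + 6 = 4d; this choice makes the coefficient odd. *)
Definition forms_fill : seq (seq nat) :=
  [:: [:: 1]; [:: 2]; [:: 2]; [:: 3]; [:: 3]; [:: 3]]%N.

Definition forms_all : seq (seq nat) := [:: [:: 0]; [:: 1]; [:: 2]; [:: 3]]%N.

Definition diag4 (n : nat) := (n, n, n, n).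

(** The transitions read the last binary digits of the exponents m of E and n of F: [step_odd_l] the
    digits 1 and 0, [step_odd_r] 0 and 1, [step_even_r] 1 and 1. The odd factors join the state, the
    rest is a square and [cartier] removes it. *)
Definition step_odd_l (l : sparse4) := cartier (mul_forms l forms_le3).
Definition step_odd_r (l : sparse4) :=
  cartier (mul_forms l (forms_all ++ forms_all ++ forms_le2)).
Definition step_even_r (l : sparse4) :=
  cartier (mul_forms l (forms_all ++ forms_all ++ forms_le3 ++ forms_le2)).

(* The fourth powers of the variables turn the exponent d = 7 * 2^q - 2 * t into
   7 * 2^q - 2 * n with n = t - 2. *)
Definition start4 : sparse4 :=
  mul_forms [:: diag4 0]
    (forms_all ++ forms_all ++ forms_all ++ forms_all ++ forms_pairs ++ forms_fill).

(** The orbit of [start4] under [step_even_r], which closes up within these three entries. *)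
Definition states_even : seq sparse4 :=
  let l1 := step_even_r start4 in [:: start4; l1; step_even_r l1].

(** Worklist search with fuel [n]; that the fuel 200 suffices is confirmed by the closure check in
    [states_closed]. *)
Fixpoint explore (n : nat) (seen todo : seq sparse4) : seq sparse4 :=
  match n, todo with
  | n'.+1, l :: todo' =>
      if l \in seen then explore n' seen todo'
      else explore n' (l :: seen) [:: step_odd_l l, step_odd_r l & todo']
  | _, _ => seen
  end.

Definition states_odd : seq sparse4 := explore 200 [::] (map cartier states_even).

(** A finite computation. The last clause ends a run, where m = 1, n = 0 and the exponent is 7. The
    existential statement keeps the explicit lists out of later proofs. *)
Lemma states_closed : exists odds evens : seq sparse4,
  [/\ start4 \in evens,
      forall l, l \in evens -> cartier l \in odds /\ step_even_r l \in evens,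
      forall l, l \in odds -> step_odd_l l \in odds /\ step_odd_r l \in odds &
      forall l, l \in odds -> odd (count_mem (diag4 7) (mul_forms l forms_le3))].
Proof.
exists states_odd, states_even; split.
- by rewrite /states_even mem_head.
- have /allP h : all (fun l => (cartier l \in states_odd) &&
    (step_even_r l \in states_even)) states_even by vm_compute.
  by move=> l /h /andP.
- have /allP h : all (fun l => (step_odd_l l \in states_odd) &&
    (step_odd_r l \in states_odd)) states_odd by vm_compute.
  by move=> l /h /andP.
- have /allP h : all (fun l => odd (count_mem (diag4 7) (mul_forms l forms_le3))) states_odd
    by vm_compute.
  exact: h.
Qed.

(** * Evaluation of the coefficient along the binary digits *)

Lemma coef4_1 x : coef4 1 x = (x == diag4 0)%:R.
Proof.
case: x => [[[x0 x1] x2] x3]; rewrite /coef4 /diag4 /= !xpair_eqE.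
rewrite coef1; case: eqP => _ /=; last by rewrite !coef0.
rewrite coef1; case: eqP => _ /=; last by rewrite !coef0.
rewrite coef1; case: eqP => _ /=; last by rewrite !coef0.
by rewrite coef1.
Qed.

Lemma coef4_mono e x : coef4 (mono4 e) x = (e == x)%:R.
Proof.
rewrite -[mono4 e]mulr1 coef4_monoM coef4_1.
case: e => [[[e0 e1] e2] e3]; case: x => [[[x0 x1] x2] x3].
rewrite /le4 /sub4 /diag4 /= !xpair_eqE.
case: ifP => [/and4P[h0 h1 h2 h3]|h]; first by congr ((nat_of_bool _)%:R); lia.
by apply/esym; rewrite (_ : (_ && _) = false) //; apply: contraFF h; lia.
Qed.

Lemma coef4_eval l x : coef4 (eval4 l) x = (odd (count_mem x l))%:R.
Proof.
elim: l => [|e l IH]; first by rewrite /eval4 big_nil coef40.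
rewrite eval4_cons coef4D IH coef4_mono /= oddD.
by case: (e == x); case: (odd _); rewrite ?addr0 ?add0r ?addF2.
Qed.

Definition prod_forms (Ts : seq (seq nat)) : poly4 := \prod_(T <- Ts) form4 T.

Lemma prod_forms_cat Ts Ts' : prod_forms (Ts ++ Ts') = prod_forms Ts * prod_forms Ts'.
Proof. exact: big_cat. Qed.

Lemma prod_forms_all : prod_forms forms_all = mono4 (diag4 1).
Proof. by rewrite /prod_forms /form4 !big_cons !big_nil /mono4 /= !expr1 !addr0 mulr1. Qed.

Lemma mono4_expr_diag n : mono4 (diag4 1) ^+ n = mono4 (diag4 n).
Proof. by rewrite /mono4 /= !expr1 !exprMn. Qed.

Lemma coef4_monoM_diag n p x : coef4 (mono4 (diag4 n) * p) (diag4 (n + x)) = coef4 p (diag4 x).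
Proof.
rewrite coef4_monoM /le4 /sub4 /= leq_addr /=.
by rewrite /diag4 addKn.
Qed.

Section Automaton.
Variables (odds evens : seq sparse4) (E F : poly4).
Hypothesis even_cartier : forall l, l \in evens -> cartier l \in odds.
Hypothesis even_step : forall l, l \in evens -> step_even_r l \in evens.
Hypothesis odd_step_l : forall l, l \in odds -> step_odd_l l \in odds.
Hypothesis odd_step_r : forall l, l \in odds -> step_odd_r l \in odds.
Hypothesis odd_final : forall l, l \in odds ->
  odd (count_mem (diag4 7) (mul_forms l forms_le3)).
Hypothesis EE : E = prod_forms forms_le3.
Hypothesis FE : F = prod_forms forms_le2.

(* One binary digit of m and n is consumed: m + n = 2^k - 1 forces the last
   digits to differ, m + n = 2^k - 2 to agree.  The product of all variables
   squared compensates the change of the exponent when n is odd. *)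
Lemma coef4_states_odd k m n l : l \in odds -> (0 < k)%N ->
  (m + n).+1 = (2 ^ k)%N -> (2 ^ k.-1 <= m)%N ->
  coef4 (eval4 l * (E ^+ m * F ^+ n)) (diag4 (7 * 2 ^ k.-1 - 2 * n)) = 1.
Proof.
case: k => // k lO _; elim: k m n l lO => [|k IH] m n l lO /=.
  (* The lower bound on [m] gives the leading digit to [m], so the run ends at m = 1, n = 0; it also
     bounds [n], so that no subtraction in the exponents is truncated. *)
  rewrite expn1 expn0 => mn m1.
  have -> : m = 1%N by lia. 
  have -> : n = 0%N by lia.
  rewrite expr1 expr0 mulr1 muln1 muln0 subn0 EE -eval4_mul_forms coef4_eval.
  by rewrite odd_final.
move=> mn mk.
have mn' : (m./2 + n./2).+1 = (2 ^ k.+1)%N.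
  rewrite expnS in mn; have := odd_double_half m; have := odd_double_half n.
  have := congr1 odd mn; rewrite /= oddD oddM /=; case: (odd m); case: (odd n) => //= _; lia.
have mk' : (2 ^ k <= m./2)%N by rewrite expnS in mk; lia.
have pE := expn_gt0 2 k.
have := odd_double_half m; have := odd_double_half n.
have : odd m = ~~ odd n.
  have := congr1 odd mn; rewrite /= oddD expnS oddM /=.
  by case: (odd m); case: (odd n).
set m' := m./2 in mn' mk' *; set n' := n./2 in mn' mk' *.
have n'k : (n' < 2 ^ k)%N by rewrite expnS in mn'; lia.
have eb : (7 * 2 ^ k - 2 * n' + (7 * 2 ^ k - 2 * n') = 7 * 2 ^ k.+1 - 4 * n')%N.
  by rewrite expnS; lia.
have IH' l' : l' \in odds ->
    coef4 (eval4 l' * (E ^+ m' * F ^+ n')) (diag4 (7 * 2 ^ k - 2 * n')) = 1.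
  by move=> h; apply: (IH m' n' l').
move=> ->; case: (odd n) => /= <- <-; rewrite ?add0n ?add1n -!muln2 ?exprS !exprM.
- rewrite -(coef4_monoM_diag 2) mulrCA -mono4_expr_diag -prod_forms_all.
  rewrite [X in coef4 X _](_ : _ = eval4 (mul_forms l (forms_all ++ forms_all ++ forms_le2)) *
      (E ^+ m' * F ^+ n') ^+ 2); last first.
    rewrite eval4_mul_forms -/(prod_forms _) !prod_forms_cat -FE; ring.
  rewrite (_ : diag4 _ = add4 (diag4 (7 * 2 ^ k - 2 * n')) (diag4 (7 * 2 ^ k - 2 * n'))); last first.
    by rewrite /add4 /= eb; congr (_, _, _, _); lia.
  rewrite coef4_cartier; apply: IH'; exact: odd_step_r.
- rewrite [X in coef4 X _](_ : _ = eval4 (mul_forms l forms_le3) * (E ^+ m' * F ^+ n') ^+ 2); last first.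
    rewrite eval4_mul_forms -/(prod_forms _) -EE; ring.
  rewrite (_ : diag4 _ = add4 (diag4 (7 * 2 ^ k - 2 * n')) (diag4 (7 * 2 ^ k - 2 * n'))); last first.
    by rewrite /add4 /= eb; congr (_, _, _, _); lia.
  rewrite coef4_cartier; apply: IH'; exact: odd_step_l.
Qed.

(** Two odd digits keep the sum of the form 2^k - 2; two even digits turn it into 2^k - 1 and lead
    to the odd states. *)
Lemma coef4_states_even k m n l : l \in evens -> (0 < k)%N ->
  (m + n).+2 = (2 ^ k)%N -> (2 ^ k.-1 <= m)%N ->
  coef4 (eval4 l * (E ^+ m * F ^+ n)) (diag4 (7 * 2 ^ k.-1 - 2 * n)) = 1.
Proof.
case: k => // k lO _; elim: k m n l lO => [|k IH] m n l lO /=.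
  (* Here m + n = 0 contradicts 1 <= m, so a run passes to the odd states before this point. *)
  rewrite expn1 expn0; lia.
move=> mn mk.
have pE := expn_gt0 2 k.
have := odd_double_half m; have := odd_double_half n.
have : odd m = odd n.
  have := congr1 odd mn; rewrite /= oddD expnS oddM /=.
  by case: (odd m); case: (odd n).
set m' := m./2; set n' := n./2.
rewrite !expnS in mn mk.
move=> omn; rewrite omn; case: (odd n) => /= nE mE.
- have n'k : (n' < 2 ^ k)%N by lia.
  rewrite -nE -mE -!muln2 !add1n !exprS !exprM.
  rewrite -(coef4_monoM_diag 2) mulrCA -mono4_expr_diag -prod_forms_all.
  rewrite [X in coef4 X _](_ : _ = eval4 (mul_forms l (forms_all ++ forms_all ++ forms_le3 ++ forms_le2)) *
      (E ^+ m' * F ^+ n') ^+ 2); last first.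
    rewrite eval4_mul_forms -/(prod_forms _) !prod_forms_cat -FE -EE; ring.
  rewrite (_ : diag4 _ = add4 (diag4 (7 * 2 ^ k - 2 * n')) (diag4 (7 * 2 ^ k - 2 * n'))); last first.
    by rewrite /add4 expnS /=; congr (_, _, _, _); lia.
  rewrite coef4_cartier -/(step_even_r l).
  by apply: IH; [exact: even_step | rewrite expnS; lia | rewrite /=; lia].
- have n'k : (n' < 2 ^ k)%N by lia.
  rewrite -nE -mE -!muln2 !add0n !exprM.
  rewrite [X in coef4 X _](_ : _ = eval4 l * (E ^+ m' * F ^+ n') ^+ 2); last by ring.
  rewrite (_ : diag4 _ = add4 (diag4 (7 * 2 ^ k - 2 * n')) (diag4 (7 * 2 ^ k - 2 * n'))); last first.
    by rewrite /add4 expnS /=; congr (_, _, _, _); lia.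
  rewrite coef4_cartier.
  by apply: (@coef4_states_odd k.+1); [exact: even_cartier | | rewrite expnS; lia | rewrite /=; lia].
Qed.

End Automaton.

(** The exponents m = 2^(q+1) - t and n = t - 2 add up to 2^(q+1) - 2, and t <= 2^q yields m >= 2^q,
    as the even phase requires. *)
Lemma coef4_tests q t : (1 <= q)%N -> (2 <= t)%N -> (t <= 2 ^ q)%N ->
  coef4 (prod_forms forms_le3 ^+ (2 ^ q.+1 - t) * prod_forms forms_le2 ^+ (t - 2) *
      prod_forms forms_pairs * prod_forms forms_fill)
    (diag4 (7 * 2 ^ q - 2 * t)) = 1.
Proof.
move=> q1 t2 tq; have pE := expn_gt0 2 q.
rewrite -(coef4_monoM_diag 4).
have -> : (4 + (7 * 2 ^ q - 2 * t) = 7 * 2 ^ q.+1.-1 - 2 * (t - 2))%N by rewrite /=; lia.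
have [odds [evens [hs he ho hf]]] := states_closed.
have := @coef4_states_even odds evens _ _ (fun l h => (he l h).1) (fun l h => (he l h).2)
  (fun l h => (ho l h).1) (fun l h => (ho l h).2) hf erefl erefl
  q.+1 (2 ^ q.+1 - t)%N (t - 2)%N start4 hs isT.
rewrite /start4 eval4_mul_forms -/(prod_forms _) !prod_forms_cat prod_forms_all.
have -> : eval4 [:: diag4 0] = 1 by rewrite /eval4 big_seq1 /mono4 /= !expr0 !mulr1.
move=> main; rewrite -[RHS]main.
- by congr coef4; rewrite -(mono4_expr_diag 4); ring.
- by rewrite expnS; lia.
- by rewrite expnS /=; lia.
Qed.

(** * Words of blocks as monomials *)

Lemma form4_ord (T : seq nat) : uniq T -> {subset T <= iota 0 4} ->
  form4 T = \sum_(j < 4 | (j : nat) \in T) var4 j.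
Proof.
move=> uT sT; rewrite /form4 -(big_mkord (fun j => j \in T) var4) /index_iota subn0 -big_filter.
apply: perm_big; apply: uniq_perm => //; first by rewrite filter_uniq ?iota_uniq.
by move=> j; rewrite mem_filter; apply/idP/andP => [jT|[]//]; rewrite jT sT.
Qed.

(** Expanding the product chooses one variable from each form, that is a word; the exponents of its
    monomial count the letters, and the word fits exactly when all of them are [d]. *)
Lemma sum_words_coef4 N d (blk : 'I_N.+1 -> 'I_4) (Ts : 'I_N.+1 -> seq nat) :
  (forall j, #|finset (fun i => blk i == j)| = d) ->
  (forall m, uniq (Ts m)) -> (forall m, {subset Ts m <= iota 0 4}) ->
  \sum_(w : {ffun 'I_N.+1 -> 'I_4} | [forall m : 'I_N.+1, (w m : nat) \in Ts m])
    (fits blk w)%:R = coef4 (\prod_m form4 (Ts m)) (diag4 d).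
Proof.
move=> hd uT sT.
under [in RHS]eq_bigr => m _ do rewrite form4_ord //.
rewrite bigA_distr_big_dep /= (big_morph (coef4^~ (diag4 d)) (fun p q => coef4D p q _) (coef40 _)).
apply: eq_big => [w|w _]; first by apply/fintype.forallP/familyP => h m; exact: h.
pose c j := #|finset (fun m => w m == j)|.
have -> : \prod_m var4 (w m) = \prod_(j < 4) var4 j ^+ c j.
  rewrite (partition_big w xpredT) //=; apply: eq_bigr => j _.
  under eq_bigr => m /eqP -> do [].
  by rewrite prodr_const /c cardsE.
have -> : \prod_(j < 4) var4 j ^+ c j =
    mono4 (c (inord 0), c (inord 1), c (inord 2), c (inord 3)).
  rewrite /mono4 /= !big_ord_recl big_ord0 mulr1 /=.
  by congr (_ ^+ c _ * (_ ^+ c _ * (_ ^+ c _ * _ ^+ c _))); apply: val_inj; rewrite /= inordK.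
rewrite coef4_mono /diag4 !xpair_eqE -!andbA; congr (nat_of_bool _)%:R.
apply/fintype.forallP/and4P => [h|].
  by split; [have := h (inord 0) | have := h (inord 1) | have := h (inord 2) |
    have := h (inord 3)]; rewrite hd.
move=> h j; rewrite hd -(inord_val j); case: j h => -[|[|[|[|//]]]] h /= [? ? ? ?]; assumption.
Qed.

(** * Hyperplanes are Lebesgue null *)

Section LebesgueNull.
Variables (R : realType) (d : nat).

(** The finite cover is continued by the degenerate box at 0, whose volume is 0 because [d] is
    positive. *)
Lemma lebesgue_null_fin (A : set 'rV[R]_d) : (0 < d)%N ->
  (forall eps : R, 0 < eps -> exists (I : finType) (a b : I -> 'rV[R]_d),
    [/\ forall k i, a k 0 i <= b k 0 i,
        forall x, A x -> exists k, box (a k) (b k) x &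
        \sum_k boxvol (a k) (b k) <= eps]) ->
  lebesgue_null A.
Proof.
move=> d0 hA eps e0; have [I [a [b [ab Aab vol]]]] := hA eps e0.
pose ext (c : I -> 'rV[R]_d) n : 'rV[R]_d :=
  if insub n : option 'I_#|I| is Some k then c (enum_val k) else 0.
exists (ext a), (ext b); split.
  by move=> n i; rewrite /ext; case: insub => [k|//]; exact: ab.
have vol0 (c : 'rV[R]_d) : boxvol c c = 0.
  by rewrite /boxvol (bigD1 (Ordinal d0)) //= subrr mul0r.
split.
  move=> x /Aab[k xk]; exists (enum_rank k) => //.
  by rewrite /ext valK enum_rankK.
rewrite (nneseries_split 0 #|I|); last first.
  move=> k _; rewrite lee_fin; apply: prodr_ge0 => i _; rewrite subr_ge0.
  by rewrite /ext; case: insub => [j|//]; exact: ab.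
rewrite eseries0 ?adde0; last first.
  move=> k; rewrite add0n => Ik _; rewrite /ext insubN ?vol0 // -leqNgt //.
rewrite add0n big_mkord sumEFin lee_fin; apply: le_trans vol.
rewrite [leRHS](reindex_onto (@enum_val I predT) enum_rank) => [|i _]; last exact: enum_rankK.
rewrite le_eqVlt; apply/orP; left; apply/eqP.
apply: eq_big => [k|k _]; last by rewrite /ext valK.
by rewrite enum_valK eqxx.
Qed.

End LebesgueNull.

Lemma subdivide (R : realType) (K : nat) (z : R) : 0 <= z <= K.+1%:R ->
  exists k : 'I_K.+1, k%:R <= z <= k.+1%:R.
Proof.
elim: K => [|K IH] /andP[z0 zK]; first by exists ord0; rewrite z0.
have [zK'|zK'] := lerP z K.+1%:R; last by exists ord_max; rewrite /= zK ltW.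
have [|k hk] := IH; first by rewrite z0.
by exists (widen_ord (leqnSn _) k).
Qed.

(** The equation is solved for a coordinate [i] with nonzero coefficient. Over each cell of a grid
    of mesh [h] in the other coordinates the solution varies by at most D h, so one thin box covers
    that part. *)
Lemma hyperplane_box_null (R : realType) d (a : 'rV[R]_d) (b : R) (m : nat) : a != 0 ->
  lebesgue_null [set u : 'rV[R]_d | dotv u a = b /\ forall i, `|u 0 i| <= m%:R].
Proof.
case: d a => [|d] a a0; first by rewrite (thinmx0 a) eqxx in a0.
have [i ai] : exists i, a 0 i != 0.
  apply/existsP; apply: contraNT a0; rewrite negb_exists => /fintype.forallP h.
  by apply/eqP/rowP => i; rewrite mxE; apply/eqP; rewrite -[_ == _]negbK.
apply: lebesgue_null_fin => // eps e0.
(* [D] is a Lipschitz constant, for the sup norm, of the solved coordinate. *)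
pose D := (\sum_(k < d) `|a 0 (lift i k)|) / `|a 0 i|.
have D0 : 0 <= D by rewrite divr_ge0 // sumr_ge0.
pose M : R := m.+1%:R; have M0 : 0 < M by rewrite ltr0n.
(* With K + 1 intervals in each direction the boxes have total volume C / (K + 1). *)
pose C := (2 * M) ^+ d * (2 * D * (2 * M)).
have C0 : 0 <= C.
  have M2 : 0 <= 2 * M by lra.
  by apply: mulr_ge0; [exact: exprn_ge0 | apply: mulr_ge0 => //; apply: mulr_ge0].
pose K := Num.truncn (C / eps).
have CK : C / eps < K.+1%:R by rewrite /K; apply: truncnS_gt.
pose h := 2 * M / K.+1%:R; have h0 : 0 < h by rewrite divr_gt0 ?mulr_gt0 ?ltr0n.
have hK : h * K.+1%:R = 2 * M by rewrite divfK // pnatr_eq0.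
pose lo (g : {ffun 'I_d -> 'I_K.+1}) k := - M + h * (g k)%:R.
pose c g := (b - \sum_(k < d) lo g k * a 0 (lift i k)) / a 0 i.
pose bx (g : {ffun 'I_d -> 'I_K.+1}) (x y : R) : 'rV[R]_d.+1 :=
  \row_j (if unlift i j is Some k then lo g k + x else c g + y).
have bxi g x y : bx g x y 0 i = c g + y by rewrite mxE unlift_none.
have bxl g x y k : bx g x y 0 (lift i k) = lo g k + x by rewrite mxE liftK.
exists {ffun 'I_d -> 'I_K.+1}, (fun g => bx g 0 (- (D * h))), (fun g => bx g h (D * h)).
have Dh0 : 0 <= D * h by rewrite mulr_ge0 // ltW.
split.
- by move=> g j; case: (unliftP i j) => [k|] ->; rewrite ?bxi ?bxl lerD2l; lra.
- move=> u [ub um].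
  have /choice[g gP] : forall k : 'I_d, exists g : 'I_K.+1,
      g%:R <= (u 0 (lift i k) + M) / h <= g.+1%:R.
    move=> k; apply: subdivide; have := um (lift i k); rewrite ler_norml => /andP[u1 u2].
    have mM : m%:R <= M by rewrite ler_nat.
    rewrite divr_ge0 ?ler_pdivrMr ?(ltW h0) //; last by lra.
    rewrite mulrC hK; lra.
  exists (finfun g) => j; case: (unliftP i j) => [k|] ->; rewrite ?bxi ?bxl.
    have := gP k; rewrite ler_pdivrMr // ler_pdivlMr // /lo ffunE addr0 => /andP[g1 g2].
    apply/andP; split; first by lra.
    by rewrite -natr1 in g2; lra.
  rewrite -ler_distl; set G := finfun g.
  have uE : u 0 i = (b - \sum_(k < d) u 0 (lift i k) * a 0 (lift i k)) / a 0 i.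
    by rewrite -ub /dotv (bigD1_ord i) //= addrK mulfK.
  rewrite {}uE /c -mulrBl opprB addrC addrA subrK -sumrB normrM normfV.
  rewrite /D mulrAC ler_wpM2r ?invr_ge0 // mulr_suml.
  apply: le_trans (ler_norm_sum _ _ _) _; apply: ler_sum => k _.
  rewrite -mulrBl normrM mulrC ler_wpM2l //.
  have := gP k; rewrite ler_pdivrMr // ler_pdivlMr // /lo ffunE => /andP[g1 g2].
  by rewrite -natr1 in g2; rewrite ler_norml; apply/andP; split; lra.
- apply: (@le_trans _ _ (C / K.+1%:R)); last first.
    rewrite ler_pdivrMr ?ltr0n // mulrC -ler_pdivrMr //; exact: ltW.
  rewrite (eq_bigr (fun=> h ^+ d * (2 * D * h))); last first.
    move=> g _; rewrite /boxvol (bigD1_ord i) //= !bxi mulrC; congr (_ * _); last by ring.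
    under eq_bigr => k _ do rewrite !bxl addr0 addrC addKr.
    by rewrite prodr_const card_ord.
  rewrite sumr_const card_ffun !card_ord -[leLHS]mulr_natl natrX mulrA -exprMn [_ * h]mulrC hK.
  by rewrite /C /h !mulrA.
Qed.
Section RealContinuity.
Variables (R : realType) (T : topologicalType).
Implicit Types f g : T -> R.

Lemma continuousDr f g : continuous f -> continuous g -> continuous (fun x => f x + g x).
Proof. by move=> fc gc x; apply: cvgD; [exact: fc | exact: gc]. Qed.

Lemma continuousMr f g : continuous f -> continuous g -> continuous (fun x => f x * g x).
Proof. by move=> fc gc x; apply: cvgM; [exact: fc | exact: gc]. Qed.

Lemma continuousNr f : continuous f -> continuous (fun x => - f x).
Proof. by move=> fc x; apply: cvgN; exact: fc. Qed.

Lemma continuous_normr f : continuous f -> continuous (fun x => `|f x|).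
Proof. by move=> fc x; apply: cvg_norm; exact: fc. Qed.

Lemma continuous_cst (c : R) : continuous (fun _ : T => c).
Proof. by move=> x; exact: cvg_cst. Qed.

Lemma continuous_sumr (I : Type) (r : seq I) (P : pred I) (f : I -> T -> R) :
  (forall i, continuous (f i)) -> continuous (fun x => \sum_(i <- r | P i) f i x).
Proof. by move=> fc; apply: continuous_big => //; exact: add_continuous. Qed.

End RealContinuity.

(** * Cells cut out by hyperplanes and the continuity of their masses *)

Section Mass.
Variables (R : realType) (d : nat).
Implicit Types (a u : 'rV[R]_d).

Lemma measurable_closed (A : set 'rV[R]_d) :
  closed A -> measurable (A : set (borelR R d)).
Proof.
move=> cA; rewrite -[A]setCK; apply: measurableC; apply: sub_sigma_algebra.
exact: closed_openC.
Qed.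

Lemma dotv_continuous a : continuous (fun u : 'rV[R]_d => dotv u a).
Proof.
apply: continuous_sumr => i; apply: continuousMr; last exact: continuous_cst.
exact: coord_continuous.
Qed.

Lemma abs_coord_continuous i : continuous (fun u : 'rV[R]_d => `|u 0 i|).
Proof. apply: continuous_normr; exact: coord_continuous. Qed.

Lemma measurable_ge (g : 'rV[R]_d -> R) (c : R) : continuous g ->
  measurable ([set u | c <= g u] : set (borelR R d)).
Proof.
move=> gc; apply: measurable_closed.
by apply: (@closed_comp _ _ g [set x | c <= x]); [move=> x _; exact: gc | exact: closed_ge].
Qed.

Lemma measurable_le (g : 'rV[R]_d -> R) (c : R) : continuous g ->
  measurable ([set u | g u <= c] : set (borelR R d)).
Proof.
move=> gc; apply: measurable_closed.
by apply: (@closed_comp _ _ g [set x | x <= c]); [move=> x _; exact: gc | exact: closed_le].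
Qed.

Lemma measurable_hyperplane a (b : R) :
  measurable ([set u | dotv u a = b] : set (borelR R d)).
Proof.
apply: measurable_closed.
by apply: (@closed_comp _ _ _ [set x | x = b]); [move=> x _; exact: dotv_continuous | exact: closed_eq].
Qed.

Variable mu : {measure set (borelR R d) -> \bar R}.
Hypothesis mass_mu : is_mass mu.

Lemma hyperplane_null a (b : R) : a != 0 -> mu [set u | dotv u a = b] = 0%E.
Proof.
move=> a0; apply: measure_negligible; first exact: measurable_hyperplane.
have -> : [set u | dotv u a = b] =
    \bigcup_(m in setT) [set u : 'rV[R]_d | dotv u a = b /\ forall i, `|u 0 i| <= m%:R].
  apply/seteqP; split => [u ub|u [m _ []]//].
  exists (Num.bound (\sum_i `|u 0 i|)) => //; split=> // i.
  apply: le_trans (ltW (archi_boundP _)); last exact: sumr_ge0.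
  by rewrite (bigD1 i) //= lerDl sumr_ge0.
apply: negligible_bigcup => m.
have mF : measurable ([set u : 'rV[R]_d | dotv u a = b /\ forall i, `|u 0 i| <= m%:R]
    : set (borelR R d)).
  rewrite (_ : [set _ | _] = [set u | dotv u a = b] `&`
      \bigcap_(i in [set: 'I_d]) [set u : 'rV[R]_d | `|u 0 i| <= m%:R]); last first.
    by apply/seteqP; split => u /= [-> h]; split=> // i; [move=> _; exact: h | exact: h].
  apply: measurableI; first exact: measurable_hyperplane.
  apply: fin_bigcap_measurable; first exact: finite_finset. move=> i _.
  apply: measurable_le; exact: abs_coord_continuous.
apply/(negligibleP _ mF); apply: mass_mu.2 => //; exact: hyperplane_box_null.
Qed.
Let fin_mu (A : set (borelR R d)) : measurable A -> mu A \is a fin_num.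
Proof.
move=> mA; rewrite ge0_fin_numE //; apply: le_lt_trans mass_mu.1.
by apply: le_measure; rewrite ?inE //; exact: measurableT.
Qed.

Lemma eq_measure_off_null (A B N' : set (borelR R d)) :
  measurable A -> measurable B -> mu.-negligible N' ->
  (forall u, ~ N' u -> A u <-> B u) -> mu A = mu B.
Proof.
move=> mA mB [N [mN N0 N'N]] AB'.
have AB u : ~ N u -> A u <-> B u by move=> nN; apply: AB' => /N'N.
rewrite -(measureU0 mA mN N0) -(measureU0 mB mN N0); congr (mu _).
apply/seteqP; split=> u [Xu|Nu]; try (by right);
  have [Nu|/AB[AtoB BtoA]] := pselect (N u); by [right | left; auto].
Qed.

Lemma dotvN u a : dotv u (- a) = - dotv u a.
Proof. by rewrite /dotv -sumrN; apply: eq_bigr => i _; rewrite mxE mulrN. Qed.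

Lemma dotvB u a a' : dotv u (a - a') = dotv u a - dotv u a'.
Proof. by rewrite /dotv -sumrB; apply: eq_bigr => i _; rewrite !mxE mulrBr. Qed.

Lemma coord_le_norm a i : `|a 0 i| <= `|a|.
Proof.
rewrite [leRHS]/Num.norm /= mx_normrE; apply/bigmax_geP; right => /=.
by exists (0, i).
Qed.

Lemma norm_dotv_le u a : `|dotv u a| <= (\sum_i `|u 0 i|) * `|a|.
Proof.
rewrite /dotv mulr_suml; apply: le_trans (ler_norm_sum _ _ _) _.
by apply: ler_sum => i _; rewrite normrM ler_wpM2l // coord_le_norm.
Qed.

(* The disc of radius 1 models a hemisphere: a hyperplane with normal vector a
   is placed at the offset 1 - `|a|, so a = 0 is the empty half-space and
   antipodal boundary points give opposite half-spaces through the origin. *)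
Definition above a u : bool := 1 - `|a| <= dotv u a.

Lemma measurable_above a : measurable ([set u | above a u] : set (borelR R d)).
Proof. apply: measurable_ge; exact: dotv_continuous. Qed.

Lemma boundary_null a : mu [set u | dotv u a = 1 - `|a|] = 0%E.
Proof.
have [->|a0] := eqVneq a 0; last exact: hyperplane_null.
rewrite (_ : [set _ | _] = set0) ?measure0 //; apply/seteqP; split => // u /=.
rewrite normr0 subr0 /dotv big1 => [/esym/eqP|i _]; first by rewrite oner_eq0.
by rewrite mxE mulr0.
Qed.

Variable k : nat.
Implicit Types (y : 'I_k -> 'rV[R]_d) (s : {ffun 'I_k -> bool}).

Definition cell y s : set (borelR R d) := [set u | forall j, above (y j) u = s j].

Lemma measurable_cell y s : measurable (cell y s).
Proof.
rewrite (_ : cell y s = \bigcap_(j in [set: 'I_k]) [set u | above (y j) u = s j]); last first.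
  by apply/seteqP; split => u h j; [move=> _; exact: h | exact: h].
apply: fin_bigcap_measurable; first exact: finite_finset.
move=> j _; case: (s j); first exact: measurable_above.
rewrite (_ : [set _ | _] = ~` [set u | above (y j) u]).
  by apply: measurableC; exact: measurable_above.
by apply/seteqP; split => u /=; case: (above _ _).
Qed.

Definition cell_mass y s : R := fine (mu (cell y s)).

(** For a normal of norm 1 the offset is 0, and negating the normal exchanges the two sides up to
    the hyperplane itself, which is null. *)
Lemma cell_mass_flip y y' s s' j : `|y j| = 1 ->
  (forall i, y' i = if i == j then - y i else y i) ->
  (forall i, s' i = (i == j) (+) s i) ->
  cell_mass y' s = cell_mass y s'.
Proof.
move=> yj1 y'E s'E; rewrite /cell_mass; congr fine.
apply: (eq_measure_off_null (N' := [set u | dotv u (y j) = 1 - `|y j|])).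
- exact: measurable_cell.
- exact: measurable_cell.
- apply/negligibleP; [exact: measurable_hyperplane | exact: boundary_null].
move=> u /= /eqP uN.
have aE i : above (y' i) u = (i == j) (+) above (y i) u.
  rewrite y'E; case: eqP => [->|//]; rewrite /above normrN dotvN yj1 subrr oppr_ge0.
  by rewrite yj1 subrr in uN; case: ltgtP uN.
by split=> h i; have := h i; rewrite aE s'E; case: (i == j) => //=;
  [move=> <-; rewrite negbK | move=> ->; rewrite negbK].
Qed.

Lemma boundaries_null y :
  mu.-negligible ([set u | exists j, dotv u (y j) = 1 - `|y j|] : set (borelR R d)).
Proof.
pose F n : set (borelR R d) := if insub n : option 'I_k is Some j then
  [set u | dotv u (y j) = 1 - `|y j|] else set0.
apply: (@negligibleS _ _ _ _ (\bigcup_n F n)) => [u [j uj]|]; first by exists j => //; rewrite /F valK.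
apply: negligible_bigcup => n; rewrite /F; case: insub => [j|]; last exact: negligible_set0.
apply/negligibleP; [exact: measurable_hyperplane | exact: boundary_null].
Qed.

(** Moving [y j] by at most 1/(n+1) changes its inner product with [u] minus the offset by at most
    this bound, so only points of the slab can change sides. *)
Let slab y n : set (borelR R d) :=
  [set u | exists j, `|dotv u (y j) - (1 - `|y j|)| <= ((\sum_i `|u 0 i|) + 1) / n.+1%:R].

Let measurable_slab y n : measurable (slab y n).
Proof.
rewrite (_ : slab y n = \bigcup_(j in [set: 'I_k])
  [set u | `|dotv u (y j) - (1 - `|y j|)| - ((\sum_i `|u 0 i|) + 1) / n.+1%:R <= 0]).
  apply: fin_bigcup_measurable; first exact: finite_finset.
  move=> j _; apply: measurable_le.
  apply: continuousDr; first apply: continuous_normr.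
    apply: continuousDr; [exact: dotv_continuous | exact: continuous_cst].
  apply: continuousNr; apply: continuousMr; last exact: continuous_cst.
  apply: continuousDr; last exact: continuous_cst.
  by apply: continuous_sumr => i; exact: abs_coord_continuous.
apply/seteqP; split => u.
  by case=> j hj; exists j => //=; rewrite subr_le0.
by case=> j _ /=; rewrite subr_le0 => hj; exists j.
Qed.

(** The slabs decrease to the union of the bounding hyperplanes, a null set, and [mu] is finite. *)
Let slab_small y (e : R) : 0 < e -> exists n, fine (mu (slab y n)) < e.
Proof.
move=> e0.
have mcap : measurable (\bigcap_n slab y n) by apply: bigcapT_measurable => n; exact: measurable_slab.
have cap0 : mu (\bigcap_n slab y n) = 0%E.
  apply/(negligibleP _ mcap).
  apply: negligibleS (boundaries_null y).
  move=> u hu; apply: contrapT => /= nF.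
    have pos j : 0 < `|dotv u (y j) - (1 - `|y j|)|.
      rewrite normr_gt0 subr_eq0; apply/negP => /eqP e1; apply: nF.
      by exists j.
    pose c := (\sum_i `|u 0 i|) + 1; have c0 : 0 < c by rewrite ltr_wpDl // sumr_ge0.
    pose S := \sum_j c / `|dotv u (y j) - (1 - `|y j|)|.
    have S0 : 0 <= S by apply: sumr_ge0 => j _; rewrite divr_ge0 // ltW.
    have [j] := hu (Num.truncn S) I; apply/negP; rewrite -ltNge -/c.
    rewrite ltr_pdivrMr ?ltr0n // mulrC -ltr_pdivrMr //.
    apply: le_lt_trans (truncnS_gt S).
    by rewrite /S (bigD1 j) //= lerDl sumr_ge0 // => i _; rewrite divr_ge0 // ltW.
have cv : mu \o slab y @ \oo --> mu (\bigcap_n slab y n).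
  apply: nonincreasing_cvg_mu => //.
  - by rewrite -ge0_fin_numE // fin_mu.
  - move=> m n mn; apply/subsetPset => u [j hj]; exists j; apply: le_trans hj _.
    rewrite ler_wpM2l //; first by rewrite addr_ge0 // sumr_ge0.
    by rewrite lef_pV2 ?posrE ?ltr0n // ler_nat.
rewrite cap0 in cv; move/fine_cvgP: cv => [_ /cvgr_lt/(_ _ e0)[n _ /(_ n (leqnn n)) hn]].
by exists n.
Qed.
Lemma dist_fine_measure (A B K : set (borelR R d)) :
  measurable A -> measurable B -> measurable K ->
  (forall u, ~ K u -> A u <-> B u) -> `|fine (mu A) - fine (mu B)| <= fine (mu K).
Proof.
have half (X Y : set (borelR R d)) : measurable X -> measurable Y -> measurable K ->
    (forall u, ~ K u -> X u <-> Y u) -> fine (mu X) <= fine (mu Y) + fine (mu K).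
  move=> mX mY mK XY; rewrite -fineD ?fin_mu //.
  apply: fine_le; rewrite ?fin_numD ?fin_mu //.
  apply: le_trans (measureU2 _ mY mK); apply: le_measure; rewrite ?inE //; first exact: measurableU.
  by move=> u Xu; have [Ku|/XY[XtoY _]] := pselect (K u); [right | left; exact: XtoY].
move=> mA mB mK AB; rewrite ler_distl lerBlDr !half // => u /AB [AtoB BtoA].
by split.
Qed.

(** The cells at two nearby parameters agree outside a slab of small mass. *)
Lemma cell_mass_continuous (V : topologicalType) (Y : 'I_k -> V -> 'rV[R]_d) s :
  (forall j, continuous (Y j)) -> continuous (fun v => cell_mass (Y^~ v) s).
Proof.
move=> Yc v; apply/cvgrPdist_lt => e e0.
have [n small] := slab_small (Y^~ v) e0.
have near_v : \forall v' \near v, forall j, `|Y j v - Y j v'| < n.+1%:R^-1.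
  apply: filter_forall => j; move/cvgrPdist_lt: (Yc j v); apply.
  by rewrite invr_gt0 ltr0n.
near=> v'.
have close j : `|Y j v - Y j v'| < n.+1%:R^-1 by move: j; near: v'.
apply: le_lt_trans small; apply: dist_fine_measure.
- exact: measurable_cell.
- exact: measurable_cell.
- exact: measurable_slab.
move=> u off.
have same j : above (Y j v) u = above (Y j v') u.
  pose S := \sum_i `|u 0 i|; have S0 : 0 <= S by rewrite sumr_ge0.
  have far : (S + 1) / n.+1%:R < `|dotv u (Y j v) - (1 - `|Y j v|)|.
    by rewrite ltNge; apply/negP => h; apply: off; exists j.
  have moved : `|(dotv u (Y j v) - (1 - `|Y j v|)) - (dotv u (Y j v') - (1 - `|Y j v'|))|
      <= (S + 1) / n.+1%:R.
    have -> : (dotv u (Y j v) - (1 - `|Y j v|)) - (dotv u (Y j v') - (1 - `|Y j v'|)) =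
      dotv u (Y j v - Y j v') + (`|Y j v| - `|Y j v'|) by rewrite dotvB; ring.
    apply: le_trans (ler_normD _ _) _; rewrite mulrDl mul1r; apply: lerD.
      apply: le_trans (norm_dotv_le _ _) _; rewrite ler_wpM2l //; exact: ltW.
    by apply: le_trans (ler_dist_dist _ _) _; exact: ltW.
  rewrite /above -[LHS]subr_ge0 -[RHS]subr_ge0.
  move: far moved; set x := dotv u (Y j v) - _; set x' := dotv u (Y j v') - _.
  set c := (S + 1) / _ => far; rewrite ler_norml => /andP[m1 m2].
  have [x0|x0] := lerP 0 x.
    by rewrite ger0_norm // in far; apply/esym; lra.
  by rewrite ltr0_norm // in far; apply/esym/negbTE; rewrite -ltNge; lra.
by split=> h j; [rewrite -same | rewrite same]; exact: h.
Unshelve. all: by end_near.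
Qed.

(** * Walsh transforms of a mass *)

Definition walsh y (T : {set 'I_k}) : R :=
  \sum_(s : {ffun 'I_k -> bool}) (\prod_(j in T) (-1) ^+ s j) * cell_mass y s.

Lemma walsh_continuous (V : topologicalType) (Y : 'I_k -> V -> 'rV[R]_d) T :
  (forall j, continuous (Y j)) -> continuous (fun v => walsh (Y^~ v) T).
Proof.
move=> Yc; apply: continuous_sumr => s; apply: continuousMr; first exact: continuous_cst.
exact: cell_mass_continuous.
Qed.

(** A flip toggles the sign [s j] of every cell, which reverses the character of [T] exactly when
    [j] is in [T]. *)
Lemma walsh_flip y y' T j : `|y j| = 1 ->
  (forall i, y' i = if i == j then - y i else y i) ->
  walsh y' T = (-1) ^+ (j \in T) * walsh y T.
Proof.
move=> yj1 y'E.
pose h s : {ffun 'I_k -> bool} := [ffun i => (i == j) (+) s i].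
have hK : involutive h by move=> s; apply/ffunP => i; rewrite !ffunE addKb.
rewrite /walsh mulr_sumr [LHS](reindex_inj (inv_inj hK)) /=; apply: eq_bigr => s _.
rewrite (@cell_mass_flip y y' (h s) s j) // => [|i]; last by rewrite ffunE addKb.
rewrite mulrA; congr (_ * _).
have [jT|njT] := boolP (j \in T); last first.
  rewrite mul1r; apply: eq_bigr => i iT; rewrite ffunE.
  by case: eqP => // ij; rewrite -ij iT in njT.
rewrite (bigD1 j) // [in RHS](bigD1 j) //= ffunE eqxx mulrA; congr (_ * _).
  by case: (s j); rewrite /= ?expr0 ?expr1 ?mulr1 ?mulrNN ?mulr1.
by apply: eq_bigr => i /andP[_ /negPf ij]; rewrite ffunE ij.
Qed.

Let agree (S : {set 'I_k}) (s0 : 'I_k -> bool) (s : {ffun 'I_k -> bool}) :=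
  [forall j, (j \in S) ==> (s j == s0 j)].

Let region_cells y (S : {set 'I_k}) (s0 : 'I_k -> bool) :
  [set u | forall j, j \in S -> above (y j) u = s0 j] =
    \bigcup_(s in [set` [seq s <- enum {ffun 'I_k -> bool} | agree S s0 s]]) cell y s.
Proof.
apply/seteqP; split => u.
  move=> h; exists [ffun j => above (y j) u] => [|j]; last by rewrite ffunE.
  rewrite /= mem_filter mem_enum andbT; apply/fintype.forallP => j.
  by apply/implyP => jS; rewrite ffunE h.
move=> [s /=]; rewrite mem_filter => /andP[/fintype.forallP h _] us j jS.
by rewrite us; apply/eqP; exact: implyP (h j) jS.
Qed.

Lemma sum_cell_mass y (S : {set 'I_k}) (s0 : 'I_k -> bool) :
  fine (mu [set u | forall j, j \in S -> above (y j) u = s0 j]) =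
  \sum_(s | agree S s0 s) cell_mass y s.
Proof.
rewrite region_cells measure_fin_bigcup //; first last.
- by move=> s _; exact: measurable_cell.
- move=> s s' _ _ [u [us us']]; apply/ffunP => j; by rewrite -us -us'.
rewrite -fsbig_seq; last by apply: filter_uniq; exact: enum_uniq.
transitivity (fine (\sum_(s | agree S s0 s) mu (cell y s))%E).
  by congr fine; rewrite big_filter big_enum_cond.
by rewrite -sum_fine // => s _; apply: fin_mu; exact: measurable_cell.
Qed.

Lemma walsh0 y : walsh y finset.set0 = fine (mu setT).
Proof.
rewrite /walsh; under eq_bigr => s _ do rewrite big_set0 mul1r.
have := sum_cell_mass y finset.set0 (fun=> false).
rewrite (_ : [set u | _] = setT) => [->|]; last by apply/seteqP; split=> // u _ j; rewrite inE.
by apply: eq_bigl => s; apply/esym/fintype.forallP => j; rewrite inE.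
Qed.

(** The product over j in S of 1 + (-1)^(s0 j + s j) is 2^|S| if [s] agrees with [s0] on [S], and 0
    otherwise. Expanded, it gives a combination of Walsh transforms in which only the empty set
    survives, with the total mass as its value. *)
Lemma walsh_inversion y (S : {set 'I_k}) (s0 : 'I_k -> bool) :
  (forall T : {set 'I_k}, T \subset S -> T != finset.set0 -> walsh y T = 0) ->
  \sum_(s | agree S s0 s) cell_mass y s = fine (mu setT) * (2 ^+ #|S|)^-1.
Proof.
move=> h.
pose x j (s : {ffun 'I_k -> bool}) : R := (j \in S)%:R * ((-1) ^+ s0 j * (-1) ^+ s j).
have xE s : \prod_j (x j s + 1) = (agree S s0 s)%:R * 2 ^+ #|S|.
  have [/fintype.forallP ag|] := boolP (agree S s0 s).
    rewrite mul1r -prodr_const [LHS](bigID (mem S)) /= [X in _ * X]big1 ?mulr1.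
      apply: eq_bigr => j jS; have := ag j; rewrite /x jS => /eqP ->.
      by rewrite mul1r -signr_addb addbb.
    by move=> j /negPf jS; rewrite /x jS mul0r add0r.
  rewrite negb_forall => /existsP[j]; rewrite negb_imply => /andP[jS ne].
  rewrite mul0r (bigD1 j) //= (_ : x j s + 1 = 0) ?mul0r // /x jS mul1r.
  by move: ne; case: (s j); case: (s0 j); rewrite //= ?expr0 ?expr1 ?mulr1 ?mul1r addNr.
apply: (mulIf (x := 2 ^+ #|S|)); first by rewrite expf_neq0 // pnatr_eq0.
rewrite divfK ?expf_neq0 ?pnatr_eq0 // -(walsh0 y) big_mkcond /= mulr_suml.
transitivity (\sum_s (\prod_j (x j s + 1)) * cell_mass y s).
  apply: eq_bigr => s _; rewrite xE; case: (agree _ _ _); rewrite ?mul0r ?mul1r //.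
  by rewrite mulrC.
under eq_bigr => s _ do rewrite bigA_distr mulr_suml.
rewrite exchange_big /= (bigD1 finset.set0) //= [X in _ + X]big1 ?addr0 => [|T T0].
  rewrite /walsh; apply: eq_bigr => s _; rewrite big1 ?big_set0 // => j _; by rewrite inE.
(* The coefficient of the transform at [T]; it vanishes unless [T] is contained in [S]. *)
pose c := \prod_(i in T) (i \in S)%:R * \prod_(i in T) (-1) ^+ s0 i : R.
have prodE s : \prod_i (if i \in T then x i s else 1) = c * \prod_(i in T) (-1) ^+ s i.
  by rewrite -big_mkcond /= /c -!big_split /=; apply: eq_bigr => i _; rewrite /x mulrA.
under eq_bigr => s _ do rewrite prodE -mulrA.
rewrite -mulr_sumr -/(walsh y T).
have [TS|] := boolP (T \subset S); first by rewrite h // mulr0.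
by case/fintype.subsetPn => j jT jS; rewrite /c (bigD1 j) //= (negPf jS) !mul0r.
Qed.

Let measurable_region y (S : {set 'I_k}) (s0 : 'I_k -> bool) :
  measurable ([set u | forall j, j \in S -> above (y j) u = s0 j] : set (borelR R d)).
Proof.
rewrite region_cells; apply: fin_bigcup_measurable; first exact: finite_finset.
by move=> s _; exact: measurable_cell.
Qed.

(** Inversion gives the mass of every region in terms of [above]; closed half-spaces change it only
    on the null bounding hyperplanes. *)
Lemma walsh_equipartition y (S : {set 'I_k}) :
  (forall T : {set 'I_k}, T \subset S -> T != finset.set0 -> walsh y T = 0) ->
  equipartition (fun j => (y j, 1 - `|y j|)) S mu.
Proof.
move=> h s0; rewrite -[mu setT]fineK ?fin_mu // -EFinM -(walsh_inversion s0 h).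
rewrite -sum_cell_mass fineK; last by (apply: fin_mu; exact: measurable_region).
apply: eq_measure_off_null (boundaries_null y) _ => [||u nb].
- apply: fin_bigcap_measurable; first exact: finite_finset.
  move=> j _; rewrite /halfspace; case: (s0 j).
    by apply: measurable_ge; exact: dotv_continuous.
  by apply: measurable_le; exact: dotv_continuous.
- exact: measurable_region.
have strict j : (dotv u (y j) <= 1 - `|y j|) = ~~ above (y j) u.
  rewrite /above -ltNge le_eqVlt; case: eqP => // e; exfalso; apply: nb; by exists j.
split=> h' j jS.
  have := h' j jS; rewrite /halfspace; case: (s0 j) => //=.
  by rewrite strict => /negbTE.
by have := h' j jS; rewrite /halfspace; case: (s0 j) => //= e; rewrite strict e.
Qed.
End Mass.

(** * Four discs as blocks of coordinates of one cube *)

Section Blocks.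
Variables (R : realType) (d : nat).
Hypothesis d0 : (0 < d)%N.
Let N := (4 * d).-1.
Let NE : N.+1 = (4 * d)%N. Proof. by rewrite prednK // muln_gt0. Qed.

Definition block_index (j : 'I_4) (i : 'I_d) : 'I_(4 * d).-1.+1 := inord (j * d + i).
Definition block_of (m : 'I_(4 * d).-1.+1) : 'I_4 := inord (m %/ d).
Definition block_row (j : 'I_4) (v : 'rV[R]_(4 * d).-1.+1) : 'rV[R]_d :=
  \row_i v 0 (block_index j i).

Let block_indexE j i : block_index j i = (j * d + i)%N :> nat.
Proof.
rewrite inordK // -/N NE; have := ltn_ord j; have := ltn_ord i.
by move: (j : nat) (i : nat) => a b bd a4; rewrite ltnS in a4; nia.
Qed.

Lemma block_of_index j i : block_of (block_index j i) = j.
Proof.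
apply: ord_inj; rewrite /block_of block_indexE divnMDl // divn_small // addn0.
by rewrite inordK.
Qed.

Lemma block_indexP m : exists i, m = block_index (block_of m) i.
Proof.
exists (Ordinal (ltn_pmod m d0)); apply: ord_inj; rewrite block_indexE /=.
rewrite inordK -?divn_eq // ltn_divLR //.
exact: leq_trans (ltn_ord m) (eq_leq NE).
Qed.

Lemma card_block j : #|finset (fun m => block_of m == j)| = d.
Proof.
have inj : injective (block_index j).
  move=> i i' e; have := block_indexE j i; rewrite e block_indexE => /addnI.
  by move/ord_inj.
rewrite -[RHS]card_ord -cardsT -(card_imset _ inj); apply: eq_card => m.
rewrite inE; apply/eqP/finset.imsetP => [<-|[i _ ->]]; last exact: block_of_index.
by have [i mi] := block_indexP m; exists i.
Qed.

Lemma row_norm_le (n : nat) (a : 'rV[R]_n) (c : R) : 0 <= c ->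
  (forall i, `|a 0 i| <= c) -> `|a| <= c.
Proof.
move=> c0 h; rewrite [leLHS]/Num.norm /= mx_normrE.
by apply/bigmax_leP; split=> // -[i j] _ /=; rewrite (ord1 i).
Qed.

Lemma block_row_continuous j : continuous (block_row j).
Proof.
move=> v; have FF := nbhs_filter v; apply/cvgrPdist_lt => e e0.
apply: filterS (nbhsx_ballx (v : 'rV[R]_(4 * d).-1.+1) e e0) => v' [_ vv'].
rewrite [ltLHS]/Num.norm /= mx_normrE; apply/bigmax_ltP; split=> // -[i i'] _ /=.
by rewrite !mxE; exact: vv'.
Qed.

(** The matrix norm is the sup norm, so four unit discs form the cube of dimension 4d, and a block
    with a coordinate of absolute value 1 is a boundary point of its disc. *)
Theorem common_zero (X : eqType) (ts : seq X) (mask : X -> seq nat)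
    (F : X -> ('I_4 -> 'rV[R]_d) -> R) :
  size ts = (4 * d)%N ->
  (forall x, uniq (mask x)) -> (forall x, {subset mask x <= iota 0 4}) ->
  coef4 (prod_forms (map mask ts)) (diag4 d) = 1 ->
  (forall x (V : topologicalType) (Y : 'I_4 -> V -> 'rV[R]_d),
    (forall j, continuous (Y j)) -> continuous (fun v => F x (Y^~ v))) ->
  (forall x j (y y' : 'I_4 -> 'rV[R]_d), `|y j| = 1 ->
    (forall i, y' i = if i == j then - y i else y i) ->
    F x y' = (-1) ^+ ((j : nat) \in mask x) * F x y) ->
  exists y, forall x, x \in ts -> F x y = 0.
Proof.
move=> size_ts uT sT coef1 F_cont F_flip.
have [x0 _] : exists x0 : X, True.
  by case: ts size_ts {coef1} => [|x]; [rewrite /=; lia | exists x].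
pose t m := nth x0 ts m.
pose f (m : 'I_N.+1) (v : 'rV[R]_N.+1) := F (t m) (block_row^~ v).
have [] := @borsuk_ulam_blocks R N 'I_4 block_of
  (fun m j => (j : nat) \in mask (t m)) f.
- by move=> m; apply: F_cont => j; exact: block_row_continuous.
- move=> m j v v1 [i ij vi]; apply: F_flip => [|j'].
    apply/eqP; rewrite eq_le row_norm_le //= => [|i']; last by rewrite mxE.
    have [i' ie] := block_indexP i; rewrite ij in ie.
    by have := coord_le_norm (block_row j v) i'; rewrite mxE -ie vi.
  apply/rowP => i'; rewrite !mxE block_of_index.
  by case: (j' == j); rewrite !mxE.
- rewrite (sum_words_coef4 card_block) // -[RHS]coef1; congr coef4.
  by rewrite /prod_forms big_map (big_nth x0) (etrans size_ts (esym NE)) big_mkord.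
move=> v hv; exists (block_row^~ v) => x /(nthP x0)[m m_lt <-].
by rewrite size_ts -NE in m_lt; exact: (hv (Ordinal m_lt)).
Qed.

End Blocks.

(** * The tests and their symmetry types *)

Lemma equipartition_zero_mass (R : realType) d (mu : {measure set (borelR R d) -> \bar R}) k
    (H : 'I_k -> hyperplane R d) (S : {set 'I_k}) :
  mu setT = 0%E -> equipartition H S mu.
Proof.
move=> mu0 s; rewrite mu0 mul0e; apply: (subset_measure0 _ _ (@subsetT _ _) mu0) => //.
apply: fin_bigcap_measurable; first exact: finite_finset.
move=> j _; rewrite /halfspace; case: (s j).
  by apply: measurable_ge; exact: dotv_continuous.
by apply: measurable_le; exact: dotv_continuous.
Qed.

Lemma dotvC (R : realType) d (u v : 'rV[R]_d) : dotv u v = dotv v u.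
Proof. by apply: eq_bigr => i _; rewrite mulrC. Qed.

Definition set_of_form (l : seq nat) : {set 'I_4} := finset (fun j : 'I_4 => (j : nat) \in l).

Definition form_of_set (T : {set 'I_4}) : seq nat := [seq j <- iota 0 4 | inord j \in T].

Lemma form_of_setK T : set_of_form (form_of_set T) = T.
Proof.
by apply/setP => j; rewrite inE mem_filter inord_val mem_iota /= ltn_ord andbT.
Qed.

Local Lemma all_ord4 (P : pred 'I_4) :
  P (inord 0) -> P (inord 1) -> P (inord 2) -> P (inord 3) -> forall j, P j.
Proof. by move=> P0 P1 P2 P3 j; rewrite -(inord_val j); case: j => -[|[|[|[|]]]]. Qed.

Lemma form_of_set_le3 (T : {set 'I_4}) :
  T != finset.set0 -> (#|T| <= 3)%N -> form_of_set T \in forms_le3.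
Proof.
move=> T0 T3; rewrite /form_of_set /=.
case: (boolP (inord 0 \in T)) => T_0; case: (boolP (inord 1 \in T)) => T_1;
case: (boolP (inord 2 \in T)) => T_2; case: (boolP (inord 3 \in T)) => T_3 //.
  have TT : T = finset.setT.
    by apply/setP => j; rewrite inE; apply: (all_ord4 (P := fun j => j \in T)).
  by rewrite TT cardsT card_ord in T3.
case/eqP: T0; apply/setP => j; rewrite inE; apply: negbTE.
by apply: (all_ord4 (P := fun j => j \notin T)).
Qed.

Lemma form_of_set_le2 (T : {set 'I_4}) : ord0 \notin T ->
  T != finset.set0 -> (#|T| <= 2)%N -> form_of_set T \in forms_le2.
Proof.
move=> T_0 T0 T2; rewrite /form_of_set /=.
have {}T_0 : inord 0 \in T = false.
  by apply/negbTE; rewrite (_ : inord 0 = ord0) //; apply: val_inj; rewrite /= inordK.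
rewrite T_0; case: (boolP (inord 1 \in T)) => T_1;
case: (boolP (inord 2 \in T)) => T_2; case: (boolP (inord 3 \in T)) => T_3 //.
  have TT : finset.setT = ord0 |: T.
    apply/setP => j; rewrite !inE; apply/esym.
    apply: (all_ord4 (P := fun j => (j == ord0) || (j \in T))); rewrite ?T_1 ?T_2 ?T_3 ?orbT //.
    by rewrite -val_eqE /= inordK.
  have := leq_ltn_trans (leq_card_setU [set ord0] T) _; rewrite -TT cardsT card_ord cards1.
  by move=> /(_ 4%N); rewrite ltnn => h; apply: h; rewrite add1n ltnS; exact: leq_trans T2 _.
case/eqP: T0; apply/setP => j; rewrite inE; apply: negbTE.
by apply: (all_ord4 (P := fun j => j \notin T)); rewrite ?T_0.
Qed.

Section Tests.
Variables (R : realType) (d m1 m2 : nat).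
Variables (mu1 : 'I_m1 -> {measure set (borelR R d) -> \bar R}).
Variables (mu2 : 'I_m2 -> {measure set (borelR R d) -> \bar R}).
Hypothesis mass1 : forall j, is_mass (mu1 j).
Hypothesis mass2 : forall j, is_mass (mu2 j).

(* The test functions: Walsh transforms of the two families of masses, inner
   products of the normals, and zero functions, whose symmetry type is free and
   which fill up the number of tests to 4 * d. *)
Definition test : eqType :=
  (('I_m1 * seq nat) + ('I_m2 * seq nat) + ('I_4 * 'I_4) + seq nat)%type.

(** An inner product is odd in each of its two blocks; the exclusive or accounts for both signs
    cancelling when the indices coincide. *)
Definition test_raw_form (x : test) : nat -> bool :=
  match x with
  | inl (inl (inl (_, l))) => fun j => j \in l
  | inl (inl (inr (_, l))) => fun j => j \in l
  | inl (inr (a, b)) => fun j => (j == a) (+) (j == b)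
  | inr l => fun j => j \in l
  end.

Definition test_form (x : test) : seq nat := [seq j <- iota 0 4 | test_raw_form x j].

Definition test_value (x : test) (y : 'I_4 -> 'rV[R]_d) : R :=
  match x with
  | inl (inl (inl (j, l))) => walsh (mu1 j) y (set_of_form l)
  | inl (inl (inr (j, l))) => walsh (mu2 j) y (set_of_form l)
  | inl (inr (a, b)) => dotv (y a) (y b)
  | inr l => 0
  end.

Definition ord_pairs : seq ('I_4 * 'I_4) :=
  let o k (h : (k < 4)%N) := Ordinal h in
  [:: (o 0 isT, o 1 isT); (o 0 isT, o 2 isT); (o 0 isT, o 3 isT);
      (o 1 isT, o 2 isT); (o 1 isT, o 3 isT); (o 2 isT, o 3 isT)]%N.

Definition tests : seq test :=
  [seq inl (inl (inl (j, l))) | j <- enum 'I_m1, l <- forms_le3] ++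
  [seq inl (inl (inr (j, l))) | j <- enum 'I_m2, l <- forms_le2] ++
  [seq inl (inr p) | p <- ord_pairs] ++ [seq inr l | l <- forms_fill].

Lemma size_tests : size tests = (m1 * 14 + (m2 * 6 + 12))%N.
Proof. by rewrite !size_cat !size_allpairs !size_enum_ord !size_map. Qed.

Lemma prod_tests : prod_forms (map test_form tests) =
  prod_forms forms_le3 ^+ m1 * prod_forms forms_le2 ^+ m2 *
  prod_forms forms_pairs * prod_forms forms_fill.
Proof.
have block m (ls : seq (seq nat)) (c : 'I_m * seq nat -> test) :
    (forall j l, l \in ls -> test_form (c (j, l)) = l) ->
    prod_forms [seq test_form x | x <- [seq c (j, l) | j <- enum 'I_m, l <- ls]] =
    prod_forms ls ^+ m.
  move=> cE; rewrite /prod_forms big_map big_allpairs_dep /=.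
  rewrite (eq_bigr (fun=> \prod_(l <- ls) form4 l)); last first.
    by move=> j _; apply: eq_big_seq => l /cE ->.
  by rewrite big_enum prodr_const card_ord.
rewrite /tests !map_cat !prod_forms_cat !mulrA.
rewrite (block _ _ (fun p => inl (inl (inl p)))); last first.
  move=> j l; rewrite /test_form /test_raw_form.
  have /allP : all (fun l => [seq j <- iota 0 4 | j \in l] == l) forms_le3 by [].
  by move=> h /h /eqP.
rewrite (block _ _ (fun p => inl (inl (inr p)))); last first.
  move=> j l; rewrite /test_form /test_raw_form.
  have /allP : all (fun l => [seq j <- iota 0 4 | j \in l] == l) forms_le2 by [].
  by move=> h /h /eqP.
by [].
Qed.

Lemma test_value_continuous x (V : topologicalType) (Y : 'I_4 -> V -> 'rV[R]_d) :
  (forall j, continuous (Y j)) -> continuous (fun v => test_value x (Y^~ v)).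
Proof.
move=> Yc; case: x => [[[[j l]|[j l]]|[a b]]|l] /=.
- exact: walsh_continuous.
- exact: walsh_continuous.
- apply: continuous_sumr => i; apply: continuousMr => v.
    apply: (@continuous_comp _ _ _ (Y a) (fun u : 'rV[R]_d => u 0 i) v (Yc a v)).
    exact: coord_continuous.
  apply: (@continuous_comp _ _ _ (Y b) (fun u : 'rV[R]_d => u 0 i) v (Yc b v)).
  exact: coord_continuous.
- exact: continuous_cst.
Qed.

Lemma test_value_flip x j (y y' : 'I_4 -> 'rV[R]_d) : `|y j| = 1 ->
  (forall i, y' i = if i == j then - y i else y i) ->
  test_value x y' = (-1) ^+ ((j : nat) \in test_form x) * test_value x y.
Proof.
move=> yj y'E; rewrite mem_filter mem_iota /= ltn_ord andbT.
case: x => [[[[m l]|[m l]]|[a b]]|l] /=.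
- by rewrite (walsh_flip (mass1 m) _ yj y'E) inE.
- by rewrite (walsh_flip (mass2 m) _ yj y'E) inE.
- rewrite !y'E !val_eqE signr_addb ![j == _]eq_sym.
  have dotNv u v : dotv (- u) v = - dotv u v :> R by rewrite dotvC dotvN dotvC.
  by case: (a == j); case: (b == j); rewrite ?dotNv ?dotvN /=; ring.
- by rewrite mulr0.
Qed.

End Tests.

(** * From a common zero to four orthogonal hyperplanes *)

Lemma equipartition_exists (R : realType) (q t : nat)
    (mu1 : 'I_(2 ^ q.+1 - t) -> {measure set (borelR R (7 * 2 ^ q - 2 * t)) -> \bar R})
    (mu2 : 'I_(t - 2) -> {measure set (borelR R (7 * 2 ^ q - 2 * t)) -> \bar R}) :
  (1 <= q)%N -> (2 <= t)%N -> (t <= 2 ^ q)%N ->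
  (forall j, is_mass (mu1 j)) -> (forall j, is_mass (mu2 j)) ->
  (forall j, mu1 j setT != 0%E) ->
  exists H : 'I_4 -> hyperplane R (7 * 2 ^ q - 2 * t),
    pairwise_orthogonal_hyperplanes H /\
    (forall S : {set 'I_4}, (#|S| <= 3)%N -> forall j, equipartition H S (mu1 j)) /\
    (forall S : {set 'I_4}, ord0 \notin S -> (#|S| <= 2)%N ->
       forall j, equipartition H S (mu2 j)).
Proof.
move=> q1 t2 tq mass1 mass2 pos1.
set d := (7 * 2 ^ q - 2 * t)%N in mu1 mu2 mass1 mass2 pos1 *.
have d0 : (0 < d)%N by rewrite /d; lia.
have [y yP] : exists y, forall x, x \in tests (2 ^ q.+1 - t) (t - 2) -> test_value mu1 mu2 x y = 0.
  apply: (common_zero d0 (mask := @test_form _ _)).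
  - by rewrite size_tests expnS /d; lia.
  - by move=> x; rewrite filter_uniq ?iota_uniq.
  - by move=> x j; rewrite mem_filter => /andP[].
  - by rewrite prod_tests coef4_tests.
  - exact: test_value_continuous.
  - exact: test_value_flip.
(* Every nonempty subset of [S] again has at most three elements, so its Walsh transform is among
   the tests. *)
have eq1 (S : {set 'I_4}) j : (#|S| <= 3)%N -> equipartition (fun i => (y i, 1 - `|y i|)) S (mu1 j).
  move=> S3; apply: walsh_equipartition => // T TS T0.
  have := yP (inl (inl (inl (j, form_of_set T)))); rewrite /= form_of_setK; apply.
  rewrite mem_cat; apply/orP; left; apply: allpairs_f; first by rewrite mem_enum.
  by apply: form_of_set_le3 => //; exact: leq_trans (subset_leq_card TS) S3.
have eq2 (S : {set 'I_4}) j : ord0 \notin S -> (#|S| <= 2)%N ->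
    equipartition (fun i => (y i, 1 - `|y i|)) S (mu2 j).
  move=> S0 S2; apply: walsh_equipartition => // T TS T0.
  have := yP (inl (inl (inr (j, form_of_set T)))); rewrite /= form_of_setK; apply.
  rewrite !mem_cat; apply/orP; right; apply/orP; left.
  apply: allpairs_f; first by rewrite mem_enum.
  apply: form_of_set_le2 => //; last exact: leq_trans (subset_leq_card TS) S2.
  by apply: contra S0; exact: fintype.subsetP TS ord0.
exists (fun i => (y i, 1 - `|y i|)); split; last by split=> S *; [exact: eq1 | exact: eq2].
split=> [i|i j]; last first.
  have orth (a b : 'I_4) : (a < b)%N -> dotv (y a) (y b) = 0.
    move=> ab; apply: (yP (inl (inr (a, b)))).
    rewrite !mem_cat; apply/orP; right; apply/orP; right; apply/orP; left.
    apply: map_f; case: a ab => -[|[|[|[|//]]]] ha; case: b => -[|[|[|[|//]]]] hb //= _;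
      by rewrite !inE !xpair_eqE -!val_eqE.
  rewrite neq_ltn => /orP[/orth //|/orth]; by rewrite dotvC.
(* If [y i] were 0, its upper half-space would be empty; but this hyperplane alone must halve a
   nonzero mass, and the first family is not empty since t <= 2^q. *)
apply/negP => /eqP /= yi0.
have m10 : (0 < 2 ^ q.+1 - t)%N by rewrite expnS; lia.
pose j0 := Ordinal m10.
have := eq1 [set i]%SET j0; rewrite cards1 => /(_ isT) /(_ (fun=> true)).
rewrite (_ : \bigcap_(_ in _) _ = set0); last first.
  apply/seteqP; split=> // u /(_ i); rewrite /= finset.in_set1 eqxx => /(_ isT).
  rewrite /halfspace /= yi0 normr0 subr0 /dotv big1 ?ler10 // => k _.
  by rewrite mxE mulr0.
rewrite measure0 => /esym/eqP; rewrite mule_eq0 (negPf (pos1 j0)) /=.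
by rewrite eqe invr_eq0 expf_eq0 pnatr_eq0 /= andbF.
Qed.

(* Indices 0,1,2,3 of 'I_4 stand for H_1,H_2,H_3,H_4.
   The 2^(q+1)-2 masses are split into the prescribed 2^(q+1)-t masses mu1
   and the remaining t-2 masses mu2. *)
Theorem theorem4p2 (R : realType) (q t : nat)
    (hq : (1 <= q)%N) (ht1 : (2 <= t)%N) (ht2 : (t <= 2 ^ q)%N)
    (mu1 : 'I_(2 ^ q.+1 - t) -> {measure set (borelR R (7 * 2 ^ q - 2 * t)) -> \bar R})
    (mu2 : 'I_(t - 2) -> {measure set (borelR R (7 * 2 ^ q - 2 * t)) -> \bar R})
    (hmu1 : forall j, is_mass (mu1 j))
    (hmu2 : forall j, is_mass (mu2 j)) :
  exists H : 'I_4 -> hyperplane R (7 * 2 ^ q - 2 * t),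
    pairwise_orthogonal_hyperplanes H /\
    (forall S : {set 'I_4}, #|S| = 3%N ->
       forall j, equipartition H S (mu1 j)) /\
    (forall S : {set 'I_4}, ord0 \notin S -> #|S| = 2%N ->
       forall j, equipartition H S (mu2 j)).
Proof.
set d := (7 * 2 ^ q - 2 * t)%N in mu1 mu2 hmu1 hmu2 *.
(* The case distinction spares the construction of a nonzero mass: if there is none, all given
   masses vanish. *)
have [[nu [nu_mass nu0]]|all0] := pselect (exists nu : {measure set (borelR R d) -> \bar R},
    is_mass nu /\ nu setT != 0%E); last first.
  have null (mu : {measure set (borelR R d) -> \bar R}) : is_mass mu -> mu setT = 0%E.
    by move=> mass_mu; apply/eqP; apply: contrapT => /negP mu0; apply: all0; exists mu.
  (* Four coordinate hyperplanes through the origin serve for zero masses; they exist because d >= 5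
     2^q. *)
  have d4 : (4 <= d)%N by rewrite /d; have := leq_pexp2l (isT : 0 < 2)%N hq; lia.
  exists (fun i => (delta_mx 0 (widen_ord d4 i), 0)); split; last first.
    by split=> S *; apply: equipartition_zero_mass; exact: null.
  split=> [i|i j ij] /=.
    by apply/eqP => /rowP/(_ (widen_ord d4 i)); rewrite !mxE !eqxx => /eqP; rewrite oner_eq0.
  rewrite /dotv big1 // => l _; rewrite !mxE eqxx /=.
  case: eqP => [->|_]; last by rewrite mul0r.
  by rewrite (_ : (_ == _) = false) ?mulr0 //; apply: contraNF ij => /eqP [/val_inj ->].
(* Zero masses are traded for nu; a hyperplane with y i = 0 would leave a
   nonzero mass unhalved, so all normals are then nonzero. *)
pose mu1' j := if mu1 j setT == 0%E then nu else mu1 j.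
have [H [orth [eq1 eq2]]] : exists H : 'I_4 -> hyperplane R d,
    pairwise_orthogonal_hyperplanes H /\
    (forall S : {set 'I_4}, (#|S| <= 3)%N -> forall j, equipartition H S (mu1' j)) /\
    (forall S : {set 'I_4}, ord0 \notin S -> (#|S| <= 2)%N ->
       forall j, equipartition H S (mu2 j)).
  apply: equipartition_exists => // j; rewrite /mu1'; first by case: ifP.
  by case: ifP => // /negbT.
exists H; split=> //; split=> [S S3 j|S S0 S2 j]; last by apply: eq2; rewrite ?S2.
have [mu0|mu0] := eqVneq (mu1 j setT) 0%E; first exact: equipartition_zero_mass.
have := eq1 S _ j; rewrite S3 /mu1' (negPf mu0); exact.
Qed.
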